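(* The class $\mathcal{S}^*_{\rho}$ satisfies the following relations: (i) $\mathcal{S}^*_{\rho} \subset \mathcal{S}^*_{\alpha} \subset \mathcal{S}^*$ for $0 \leq \alpha \leq 1-\sinh^{-1}(1)$; (ii) $\mathcal{S}^*_{\rho} \subset M(\beta)$ for $\beta \geq 1+\sinh^{-1}(1)$; (iii) $\mathcal{S}^*_{\rho} \subset \mathcal{SS}^*(\gamma)$ for $(2/\pi)\tan^{-1}(1/t) \leq \gamma \leq 1$, where $t=\dfrac{4}{\pi} \sqrt{\sinh^{-1}(1)\,(1-\sinh^{-1}(1))}$; (iv) $k\text{-}\mathcal{ST} \subset \mathcal{S}^*_{\rho}$ for $k \geq 1+1/\sinh^{-1}(1)$.
   Context: $\mathbb{D}=\{z\in\mathbb{C}:|z|<1\}$. $\mathcal{A}$ is the class of analytic functions $f$ on $\mathbb{D}$ with $f(z)=z+a_2z^2+a_3z^3+\cdots$; $\mathcal{S}\subset\mathcal{A}$ is the subclass of univalent functions. For analytic $g,h$ on $\mathbb{D}$, $g\prec h$ (subordination) means $g=h\circ\omega$ for some analytic $\omega$ on $\mathbb{D}$ with $\omega(0)=0$ and $|\omega(z)|\le|z|$. $\sinh^{-1}(z)=\ln(z+\sqrt{1+z^2})$ is the principal branch (analytic in $\mathbb{D}$, $\sinh^{-1}(0)=0$). $\mathcal{S}^*_{\rho}=\{f\in\mathcal{A}: zf'(z)/f(z)\prec 1+\sinh^{-1}(z)\}$. For $0\le\alpha<1$, $\mathcal{S}^*_\alpha=\{f\in\mathcal{S}: zf'(z)/f(z)\prec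 (1+(1-2\alpha)z)/(1-z)\}$ (starlike functions of order $\alpha$), and $\mathcal{S}^*=\mathcal{S}^*_0$. For $\beta>1$, $M(\beta)=\{f\in\mathcal{A}:\operatorname{Re}(zf'(z)/f(z))<\beta,\ z\in\mathbb{D}\}$. For $0<\gamma\le1$, $\mathcal{SS}^*(\gamma)=\{f\in\mathcal{S}: zf'(z)/f(z)\prec ((1+z)/(1-z))^\gamma\}$ (strongly starlike functions of order $\gamma$). For $k\ge0$, $k\text{-}\mathcal{ST}=\{f\in\mathcal{A}:\operatorname{Re}(zf'(z)/f(z))>k\,|zf'(z)/f(z)-1|,\ z\in\mathbb{D}\}$. *)

(* Defs.v *)
From Stdlib Require Import Reals.
From Coquelicot Require Import Coquelicot.
Open Scope C_scope.

Definition inD (z : C) : Prop := (Cmod z < 1)%R.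

Definition Cexp (z : C) : C :=
  ((exp (Re z) * cos (Im z))%R, (exp (Re z) * sin (Im z))%R).

(* Principal argument, with values in ]-PI, PI]; meaningless at z = 0. *)
Definition Carg (z : C) : R :=
  if Rle_dec 0 (Im z) then acos (Re z / Cmod z) else (- acos (Re z / Cmod z))%R.

Definition Clog (z : C) : C := (ln (Cmod z), Carg z).

(* Principal power, for w <> 0. *)
Definition Cpower (w : C) (a : R) : C := Cexp (RtoC a * Clog w).

Definition Casinh (z : C) : C := Clog (z + Cpower (1 + z * z) (1 / 2)).

Definition analytic_on_D (f : C -> C) : Prop :=
  forall z : C, inD z -> @ex_derive C_AbsRing C_NormedModule f z.

(* Functions on D are represented by total functions C -> C; all the
   conditions below only involve their values on the open set D. *)
Definition class_A (f : C -> C) : Prop :=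
  analytic_on_D f /\
  exists a : nat -> C, a 0%nat = 0 /\ a 1%nat = 1 /\
    forall z : C, inD z -> @is_pseries C_AbsRing C_NormedModule a z (f z).

Definition class_S (f : C -> C) : Prop :=
  class_A f /\
  forall z w : C, inD z -> inD w -> f z = f w -> z = w.

Definition subordinate (g h : C -> C) : Prop :=
  exists omega : C -> C,
    analytic_on_D omega /\ omega 0 = 0 /\
    (forall z : C, inD z -> (Cmod (omega z) <= Cmod z)%R) /\
    (forall z : C, inD z -> g z = h (omega z)).

(* z f'(z) / f(z), with its removable singularity at 0 filled in by the limit
   value 1 (for f in class A). *)
Definition zlogder (f : C -> C) (z : C) : C :=
  if Ceq_dec z 0 then 1 else z * C_derive f z / f z.

(* The classes defined through z f'(z) / f(z) presuppose that this quotient has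
   no pole in D.  Division is total here, so this has to be required; within
   class S it follows from injectivity. *)
Definition zlogder_defined (f : C -> C) : Prop :=
  forall z : C, inD z -> z <> 0 -> f z <> 0.

Definition starlike_rho (f : C -> C) : Prop :=
  class_A f /\ zlogder_defined f /\
  subordinate (zlogder f) (fun z => 1 + Casinh z).

Definition starlike_order (alpha : R) (f : C -> C) : Prop :=
  class_S f /\
  subordinate (zlogder f)
    (fun z => (1 + RtoC (1 - 2 * alpha) * z) / (1 - z)).

Definition starlike (f : C -> C) : Prop := starlike_order 0 f.

Definition class_M (beta : R) (f : C -> C) : Prop :=
  class_A f /\ zlogder_defined f /\
  forall z : C, inD z -> (Re (zlogder f z) < beta)%R.

Definition strongly_starlike (gamma : R) (f : C -> C) : Prop :=
  class_S f /\
  subordinate (zlogder f) (fun z => Cpower ((1 + z) / (1 - z)) gamma).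

Definition class_kST (k : R) (f : C -> C) : Prop :=
  class_A f /\ zlogder_defined f /\
  forall z : C, inD z ->
    (Re (zlogder f z) > k * Cmod (zlogder f z - 1))%R.

(* Main.v *)
(* Composing with the Schwarz function given by the hypothesis reduces each of the
   first three inclusions to a bound |g(w)| <= |w| for an explicit map g of the
   disc with g(0) = 0 and |g| <= 1, that is, to the Schwarz lemma; the last one
   applies it to sinh(z f'/f - 1).  For functions with two complex derivatives
   the Schwarz lemma needs no integration:
   |phi(e^w) e^(-s w)|^2 + eps (Re w)^2 has positive Laplacian on the half-plane
   Re w < 0, so it has no local maximum, and s -> 1 gives |phi(z)| <= M |z|.

   Writing arcsinh w = u + iv, one has sinh^2 u + sin^2 v = |w|^2 < 1, whence
   |u| < arcsinh 1 and |arcsinh w| < pi/2.  The sector bound behind the strong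
   starlikeness is the numerical inequality cos v <= sinh (1 - v/m), with m
   slightly below 1/t.

   Univalence: if f = z F and z F'/F = arcsinh(omega(z)), then |F'/F| <= pi/2
   by the Schwarz lemma for arcsinh, so
   Re F > 0; thus log f(e^w) is a well defined function on the half-plane
   Re w < 0, and its derivative has positive real part. *)
Require Import Defs.
From Stdlib Require Import Reals Lra Lia Psatz List ClassicalEpsilon.
From Coquelicot Require Import Coquelicot.
Open Scope R_scope.

(** * Complex derivatives *)

(** Without Cauchy's formula one complex derivative does not yield a second, and the map [omega] of
    a subordination is only known to have one. The Schwarz lemma is therefore never applied to
    [omega], whose bound is part of the hypothesis, but to maps whose two derivatives come from the
    chain rule. For [f] itself they come from termwise differentiation of its power series; this is
    what makes sinh(z f'/f - 1) accessible.

    Univalence has to be proved because [starlike_order] and [strongly_starlike] require class S,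
    while [starlike_rho] only provides class A. The usual argument principle is replaced by a
    logarithm of F = f/z. The principal one will do, because the best constant in |arcsinh w| <=
    (pi/2) |w| is exactly the half-opening of the right half-plane.

    The constant 1/t is the slope of the tangent from 0 to the parabola with vertex 1 - arcsinh 1
    through 1 + i pi/2 and 1 - i pi/2, the values of 1 + arcsinh at -1, i and -i. The image of the
    disc only just fits into the resulting sector, so the numerical bounds must be sharp. *)

Definition cder (f : C -> C) (z l : C) : Prop :=
  @is_derive C_AbsRing C_NormedModule f z l.
Arguments cder f%_function_scope z%_C_scope l%_C_scope.

Lemma cder_eps (f : C -> C) (z l : C) :
  cder f z l <->
  forall eps : R, 0 < eps -> exists d : R, 0 < d /\
    forall w : C, Cmod (w - z) < d ->
      Cmod (f w - f z - l * (w - z)) <= eps * Cmod (w - z).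
Proof.
split.
- intros [_ H] eps Heps.
  destruct (H z (fun P HP => HP) (mkposreal eps Heps)) as [d Hd].
  exists d; split; [apply cond_pos|].
  intros w Hw.
  generalize (Hd w Hw). simpl.
  replace (f w - f z - l * (w - z))%C
    with (@minus C_AbelianGroup (@minus C_AbelianGroup (f w) (f z))
           (@scal C_Ring C_ModuleSpace (@minus C_AbelianGroup w z) l)).
  + intros K; exact K.
  + change (f w + - f z + - ((w + - z) * l) = f w - f z - l * (w - z))%C. ring.
- intros H. split.
  + apply (is_linear_scal_l (K := C_AbsRing) (V := C_NormedModule)).
  + intros x Hx eps.
    assert (x = z) as ->.
    { apply (@is_filter_lim_locally_unique C_AbsRing (AbsRing_NormedModule C_AbsRing) z x) in Hx; auto. }
    destruct (H eps (cond_pos eps)) as [d [Hd H']].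
    exists (mkposreal d Hd). intros w Hw.
    specialize (H' w Hw).
    replace (f w - f z - l * (w - z))%C
    with (@minus C_AbelianGroup (@minus C_AbelianGroup (f w) (f z))
           (@scal C_Ring C_ModuleSpace (@minus C_AbelianGroup w z) l)) in H'.
    exact H'.
    change (f w + - f z + - ((w + - z) * l) = f w - f z - l * (w - z))%C. ring.
Qed.

Lemma cder_ext_loc (f g : C -> C) (z l : C) (d : R) : 0 < d ->
  (forall w, Cmod (w - z) < d -> f w = g w) -> cder f z l -> cder g z l.
Proof.
intros Hd H. rewrite !cder_eps. intros K eps He.
destruct (K eps He) as [d' [Hd' K']].
exists (Rmin d d'); split; [apply Rmin_pos; auto|].
intros w Hw. rewrite <- (H w), <- (H z).
- apply K'. eapply Rlt_le_trans; [exact Hw|apply Rmin_r].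
- replace (z - z)%C with (RtoC 0) by ring. now rewrite Cmod_0.
- eapply Rlt_le_trans; [exact Hw|apply Rmin_l].
Qed.

Lemma cder_eq (f : C -> C) (z l l' : C) : cder f z l -> l = l' -> cder f z l'.
Proof. now intros H <-. Qed.

Lemma cder_const (c z : C) : cder (fun _ => c) z 0.
Proof. apply (@is_derive_const C_AbsRing C_NormedModule). Qed.

Lemma cder_id (z : C) : cder (fun w => w) z 1.
Proof.
apply cder_eps; intros eps He; exists 1; split; [lra|]; intros w _.
replace (w - z - 1 * (w - z))%C with (RtoC 0) by ring.
rewrite Cmod_0. apply Rmult_le_pos; [lra|apply Cmod_ge_0].
Qed.

Lemma cder_plus (f g : C -> C) (z a b : C) :
  cder f z a -> cder g z b -> cder (fun w => (f w + g w)%C) z (a + b).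
Proof. apply (@is_derive_plus C_AbsRing C_NormedModule). Qed.

Lemma cder_local_lipschitz (f : C -> C) (z l : C) : cder f z l ->
  exists d : R, 0 < d /\ forall w : C, Cmod (w - z) < d ->
    Cmod (f w - f z) <= (Cmod l + 1) * Cmod (w - z).
Proof.
intros H. destruct (proj1 (cder_eps _ _ _) H 1 Rlt_0_1) as [d [Hd K]].
exists d; split; auto. intros w Hw. specialize (K w Hw).
replace (f w - f z)%C with ((f w - f z - l * (w - z)) + l * (w - z))%C by ring.
eapply Rle_trans; [apply Cmod_triangle|]. rewrite Cmod_mult. lra.
Qed.

Lemma cder_continuous (f : C -> C) (z l : C) : cder f z l ->
  forall eps : R, 0 < eps -> exists d : R, 0 < d /\
    forall w : C, Cmod (w - z) < d -> Cmod (f w - f z) < eps.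
Proof.
intros H eps He. destruct (cder_local_lipschitz _ _ _ H) as [d [Hd K]].
pose proof (Cmod_ge_0 l).
exists (Rmin d (eps / (Cmod l + 1))). split.
{ apply Rmin_pos; auto. apply Rdiv_lt_0_compat; lra. }
intros w Hw.
eapply Rle_lt_trans; [apply K; eapply Rlt_le_trans; [exact Hw|apply Rmin_l]|].
assert (Cmod (w - z) < eps / (Cmod l + 1)) by (eapply Rlt_le_trans; [exact Hw|apply Rmin_r]).
apply Rlt_le_trans with ((Cmod l + 1) * (eps / (Cmod l + 1))).
- apply Rmult_lt_compat_l; lra.
- right; field; lra.
Qed.

Lemma cder_comp (f g : C -> C) (z a b : C) :
  cder f (g z) a -> cder g z b -> cder (fun w => f (g w)) z (a * b).
Proof.
intros Hf Hg. apply cder_eps. intros eps He.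
destruct (cder_local_lipschitz _ _ _ Hg) as [d1 [Hd1 L]].
pose proof (Cmod_ge_0 a) as Ha. pose proof (Cmod_ge_0 b) as Hb.
set (e1 := eps / 2 / (Cmod b + 1)).
set (e2 := eps / 2 / (Cmod a + 1)).
assert (He1 : 0 < e1) by (unfold e1; repeat apply Rdiv_lt_0_compat; lra).
assert (He2 : 0 < e2) by (unfold e2; repeat apply Rdiv_lt_0_compat; lra).
destruct (proj1 (cder_eps _ _ _) Hf e1 He1) as [d2 [Hd2 F]].
destruct (proj1 (cder_eps _ _ _) Hg e2 He2) as [d3 [Hd3 G]].
destruct (cder_continuous _ _ _ Hg d2 Hd2) as [d4 [Hd4 K]].
exists (Rmin d1 (Rmin d3 d4)). split; [repeat apply Rmin_pos; auto|].
intros w Hw.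
assert (W1 : Cmod (w - z) < d1) by (eapply Rlt_le_trans; [exact Hw|apply Rmin_l]).
assert (W3 : Cmod (w - z) < d3) by (eapply Rlt_le_trans; [exact Hw|eapply Rle_trans; [apply Rmin_r|apply Rmin_l]]).
assert (W4 : Cmod (w - z) < d4) by (eapply Rlt_le_trans; [exact Hw|eapply Rle_trans; [apply Rmin_r|apply Rmin_r]]).
specialize (L w W1). specialize (G w W3). specialize (F (g w) (K w W4)).
replace (f (g w) - f (g z) - a * b * (w - z))%C
  with ((f (g w) - f (g z) - a * (g w - g z)) + a * (g w - g z - b * (w - z)))%C by ring.
eapply Rle_trans; [apply Cmod_triangle|]. rewrite Cmod_mult.
pose proof (Cmod_ge_0 (w - z)) as Hn.
assert (A1 : e1 * Cmod (g w - g z) <= eps / 2 * Cmod (w - z)).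
{ apply Rle_trans with (e1 * ((Cmod b + 1) * Cmod (w - z))).
  - apply Rmult_le_compat_l; lra.
  - unfold e1; right; field; lra. }
assert (A2 : Cmod a * Cmod (g w - g z - b * (w - z)) <= eps / 2 * Cmod (w - z)).
{ apply Rle_trans with ((Cmod a + 1) * (e2 * Cmod (w - z))).
  - apply Rmult_le_compat; try lra. apply Cmod_ge_0.
  - unfold e2; right; field; lra. }
lra.
Qed.

Lemma cder_square (z : C) : cder (fun w => (w * w)%C) z (2 * z).
Proof.
apply cder_eps. intros eps He. exists eps; split; auto. intros w Hw.
replace (w * w - z * z - 2 * z * (w - z))%C with ((w - z) * (w - z))%C by ring.
rewrite Cmod_mult. apply Rmult_le_compat_r; [apply Cmod_ge_0|lra].
Qed.

Lemma cder_scal (c : C) (f : C -> C) (z a : C) :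
  cder f z a -> cder (fun w => (c * f w)%C) z (c * a).
Proof.
intros H. apply (cder_comp (fun w => (c * w)%C) f z c a); auto.
apply cder_eps; intros eps He; exists 1; split; [lra|]; intros w _.
replace (c * w - c * f z - c * (w - f z))%C with (RtoC 0) by ring.
rewrite Cmod_0. apply Rmult_le_pos; [lra|apply Cmod_ge_0].
Qed.

(* Polarization: [4 f g = (f + g)^2 - (f - g)^2]. *)
Lemma cder_mult (f g : C -> C) (z a b : C) :
  cder f z a -> cder g z b ->
  cder (fun w => (f w * g w)%C) z (a * g z + f z * b).
Proof.
intros Hf Hg.
assert (Hp := cder_plus _ _ _ _ _ Hf Hg).
assert (Hm := cder_plus _ _ _ _ _ Hf (cder_scal (-1) _ _ _ Hg)).
apply (cder_comp _ _ _ _ _ (cder_square _)) in Hp.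
apply (cder_comp _ _ _ _ _ (cder_square _)) in Hm.
assert (H := cder_scal (/4) _ _ _ (cder_plus _ _ _ _ _ Hp (cder_scal (-1) _ _ _ Hm))).
apply (cder_ext_loc _ (fun w => (f w * g w)%C) _ _ 1 Rlt_0_1) in H.
- eapply cder_eq; [exact H|]. simpl. field.
- intros w _. simpl. field.
Qed.

Lemma cder_inv (z : C) : z <> 0%C -> cder Cinv z (- (/ z * / z)).
Proof.
intros Hz. apply cder_eps. intros eps He.
assert (Hm : 0 < Cmod z) by now apply Cmod_gt_0.
set (m := Cmod z) in *.
(* For |w - z| < m / 2 one has |w| > m / 2, so the remainder (w - z)^2 / (w z^2) is at most 2 |w -
   z|^2 / m^3. *)
exists (Rmin (m / 2) (eps * (m * m * m / 2))). split.
{ apply Rmin_pos; [lra|]. repeat (apply Rmult_lt_0_compat; auto). lra. }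
intros w Hw.
assert (W1 : Cmod (w - z) < m / 2) by (eapply Rlt_le_trans; [exact Hw|apply Rmin_l]).
assert (W2 : Cmod (w - z) < eps * (m * m * m / 2)) by (eapply Rlt_le_trans; [exact Hw|apply Rmin_r]).
assert (Wm : m / 2 < Cmod w).
{ assert (m <= Cmod w + Cmod (w - z)).
  { unfold m. replace z with (w + - (w - z))%C at 1 by ring.
    eapply Rle_trans; [apply Cmod_triangle|]. rewrite Cmod_opp. lra. }
  lra. }
assert (Hw0 : w <> 0%C) by (apply Cmod_gt_0; lra).
replace (/ w - / z - - (/ z * / z) * (w - z))%C
  with ((w - z) * (w - z) * (/ w * (/ z * / z)))%C by (field; auto).
rewrite !Cmod_mult, !Cmod_inv by auto. fold m.
pose proof (Cmod_ge_0 (w - z)).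
rewrite Rmult_assoc, (Rmult_comm eps). apply Rmult_le_compat_l; auto.
assert (I : / Cmod w <= / (m / 2)) by (apply Rinv_le_contravar; lra).
assert (J : 0 < / m * / m) by (apply Rmult_lt_0_compat; apply Rinv_0_lt_compat; auto).
apply Rle_trans with (Cmod (w - z) * (/ (m / 2) * (/ m * / m))).
- apply Rmult_le_compat_l; auto. apply Rmult_le_compat_r; lra.
- apply Rle_trans with (eps * (m * m * m / 2) * (/ (m / 2) * (/ m * / m))).
  + apply Rmult_le_compat_r; [|lra].
    apply Rmult_le_pos; [|lra]. left; apply Rinv_0_lt_compat; lra.
  + right; field; lra.
Qed.

(** * Functions with two complex derivatives on a set *)

Definition hol2 (U : C -> Prop) (f : C -> C) : Prop :=
  exists f1 f2 : C -> C, forall z, U z -> cder f z (f1 z) /\ cder f1 z (f2 z).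

Lemma hol2_sub (U V : C -> Prop) f : (forall z, U z -> V z) -> hol2 V f -> hol2 U f.
Proof. intros H [f1 [f2 K]]. exists f1, f2. auto. Qed.

Lemma hol2_cder (U : C -> Prop) f : hol2 U f -> forall z, U z -> exists l, cder f z l.
Proof. intros [f1 [f2 K]] z Hz. exists (f1 z). now apply K. Qed.

Lemma hol2_const U c : hol2 U (fun _ => c).
Proof. exists (fun _ => 0%C), (fun _ => 0%C). intros z _. split; apply cder_const. Qed.

Lemma hol2_id U : hol2 U (fun z => z).
Proof. exists (fun _ => 1%C), (fun _ => 0%C). intros z _. split; [apply cder_id|apply cder_const]. Qed.

Lemma hol2_plus U f g : hol2 U f -> hol2 U g -> hol2 U (fun z => (f z + g z)%C).
Proof.
intros [f1 [f2 F]] [g1 [g2 G]].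
exists (fun z => (f1 z + g1 z)%C), (fun z => (f2 z + g2 z)%C).
intros z Hz. destruct (F z Hz), (G z Hz). split; apply cder_plus; auto.
Qed.

Lemma hol2_mult U f g : hol2 U f -> hol2 U g -> hol2 U (fun z => (f z * g z)%C).
Proof.
intros [f1 [f2 F]] [g1 [g2 G]].
exists (fun z => (f1 z * g z + f z * g1 z)%C),
  (fun z => ((f2 z * g z + f1 z * g1 z) + (f1 z * g1 z + f z * g2 z))%C).
intros z Hz. destruct (F z Hz), (G z Hz).
split; [|apply cder_plus]; apply cder_mult; auto.
Qed.

Lemma hol2_comp (U V : C -> Prop) f g : (forall z, U z -> V (g z)) ->
  hol2 V f -> hol2 U g -> hol2 U (fun z => f (g z)).
Proof.
intros HUV [f1 [f2 F]] [g1 [g2 G]].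
exists (fun z => (f1 (g z) * g1 z)%C),
  (fun z => (f2 (g z) * g1 z * g1 z + f1 (g z) * g2 z)%C).
intros z Hz. destruct (F (g z) (HUV z Hz)), (G z Hz). split.
- now apply (cder_comp f g).
- apply (cder_mult (fun z => f1 (g z))); auto. now apply (cder_comp f1 g).
Qed.

Lemma hol2_Cinv : hol2 (fun z : C => z <> 0%C) Cinv.
Proof.
exists (fun z => (- (/ z * / z))%C),
  (fun z => (-1 * (- (/ z * / z) * / z + / z * - (/ z * / z)))%C).
intros z Hz. split; [now apply cder_inv|].
apply (cder_ext_loc (fun z => (-1 * (/ z * / z))%C) _ _ _ 1 Rlt_0_1).
- intros; ring.
- apply cder_scal, cder_mult; now apply cder_inv.
Qed.

Lemma hol2_div (U : C -> Prop) (f g : C -> C) : (forall z, U z -> g z <> 0%C) ->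
  hol2 U f -> hol2 U g -> hol2 U (fun z => (f z / g z)%C).
Proof.
intros H Hf Hg. apply hol2_mult; auto.
apply (hol2_comp _ (fun z : C => z <> 0%C) Cinv); auto using hol2_Cinv.
Qed.

(** The bridge to real calculus. Real and imaginary part are treated at once, as an additive,
    real-homogeneous functional bounded by the modulus. *)
Lemma cder_line_Re (f : C -> C) (z0 e l : C) (t : R) :
  cder f (z0 + t * e) l ->
  is_derive (fun t : R => Re (f (z0 + t * e)%C)) t (Re (l * e)) /\
  is_derive (fun t : R => Im (f (z0 + t * e)%C)) t (Im (l * e)).
Proof.
intros H.
assert (Key : forall (P : C -> R), (forall x, Rabs (P x) <= Cmod x) ->
  (forall x y, P (x - y)%C = P x - P y) -> (forall (x : R) y, P (x * y)%C = x * P y) ->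
  is_derive (fun t : R => P (f (z0 + t * e)%C)) t (P (l * e)%C)).
{ intros P HP Hm Hs. apply is_derive_Reals. intros eps Heps.
  pose proof (Cmod_ge_0 e) as Ce.
  assert (He : 0 < eps / (Cmod e + 1) / 2) by (repeat apply Rdiv_lt_0_compat; lra).
  destruct (proj1 (cder_eps _ _ _) H _ He) as [d [Hd K]].
  assert (Hd' : 0 < d / (Cmod e + 1)) by (apply Rdiv_lt_0_compat; lra).
  exists (mkposreal _ Hd'). intros h Hh0 Hh. simpl in Hh.
  specialize (K (z0 + RtoC (t + h) * e)%C).
  assert (E : (z0 + RtoC (t + h) * e - (z0 + t * e))%C = (h * e)%C)
    by (rewrite RtoC_plus; ring).
  rewrite E, Cmod_mult, Cmod_R in K.
  assert (hp : 0 < Rabs h) by now apply Rabs_pos_lt.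
  assert (Rabs h * Cmod e < d).
  { apply Rle_lt_trans with (Rabs h * (Cmod e + 1)).
    - apply Rmult_le_compat_l; lra.
    - apply (Rmult_lt_compat_r (Cmod e + 1)) in Hh; [|lra].
      replace (d / (Cmod e + 1) * (Cmod e + 1)) with d in Hh by (field; lra). lra. }
  specialize (K H0).
  replace ((P (f (z0 + RtoC (t + h) * e)%C) - P (f (z0 + t * e)%C)) / h - P (l * e)%C)
    with (P (f (z0 + RtoC (t + h) * e)%C - f (z0 + t * e)%C - l * (h * e))%C / h).
  2:{ rewrite !Hm. replace (l * (h * e))%C with (h * (l * e))%C by ring.
      rewrite Hs. field. auto. }
  unfold Rdiv at 1. rewrite Rabs_mult, Rabs_inv.
  apply Rle_lt_trans with (eps / (Cmod e + 1) / 2 * (Rabs h * Cmod e) * / Rabs h).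
  { apply Rmult_le_compat_r; [left; now apply Rinv_0_lt_compat|].
    eapply Rle_trans; [apply HP|exact K]. }
  apply Rle_lt_trans with (eps / 2 * (Cmod e / (Cmod e + 1))).
  { right. field. split; lra. }
  assert (Cmod e / (Cmod e + 1) <= 1).
  { apply Rmult_le_reg_r with (Cmod e + 1); [lra|].
    unfold Rdiv; rewrite Rmult_assoc, Rinv_l; lra. }
  assert (0 <= Cmod e / (Cmod e + 1)).
  { apply Rmult_le_pos; [lra|]. left; apply Rinv_0_lt_compat; lra. }
  nra. }
split; apply Key.
- apply re_le_Cmod.
- intros [a b] [c d]; simpl; ring.
- intros x [a b]; simpl; ring.
- intros [a b]. eapply Rle_trans; [|apply (Rmax_Cmod (a, b))]. apply Rmax_r.
- intros [a b] [c d]; simpl; ring.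
- intros x [a b]; simpl; ring.
Qed.

(** * The exponential and the principal logarithm *)

Lemma Re_mult (z w : C) : Re (z * w) = Re z * Re w - Im z * Im w.
Proof. destruct z, w; reflexivity. Qed.

Lemma Im_mult (z w : C) : Im (z * w) = Re z * Im w + Im z * Re w.
Proof. destruct z, w; reflexivity. Qed.

Lemma Re_plus (z w : C) : Re (z + w) = Re z + Re w.
Proof. destruct z, w; reflexivity. Qed.

Lemma Im_plus (z w : C) : Im (z + w) = Im z + Im w.
Proof. destruct z, w; reflexivity. Qed.

Lemma C_eq (z w : C) : Re z = Re w -> Im z = Im w -> z = w.
Proof. destruct z, w; simpl; intros; congruence. Qed.

Lemma im_le_Cmod (z : C) : Rabs (Im z) <= Cmod z.
Proof. eapply Rle_trans; [|apply (Rmax_Cmod z)]. apply Rmax_r. Qed.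

Lemma Rle_of_sq (x y : R) : 0 <= y -> x ^ 2 <= y ^ 2 -> x <= y.
Proof. intros; nra. Qed.

Lemma Cmod_le_sum (z : C) : Cmod z <= Rabs (Re z) + Rabs (Im z).
Proof.
pose proof (Rabs_pos (Re z)). pose proof (Rabs_pos (Im z)).
apply Rle_of_sq; [lra|]. rewrite Cmod2_alt.
rewrite <- (pow2_abs (Re z)), <- (pow2_abs (Im z)). nra.
Qed.

Lemma Cmod_lt_of_sq (z : C) (r : R) : 0 <= r -> Re z ^ 2 + Im z ^ 2 < r ^ 2 -> Cmod z < r.
Proof.
intros Hr H. rewrite <- Cmod2_alt in H. pose proof (Cmod_ge_0 z). nra.
Qed.

Lemma Cmod_pos_of_Re (z : C) : 0 < Re z -> 0 < Cmod z.
Proof.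
intros H. pose proof (re_le_Cmod z). pose proof (Rle_abs (Re z)). lra.
Qed.

Lemma neq0_of_Re (z : C) : 0 < Re z -> z <> 0%C.
Proof. intros H. apply Cmod_gt_0. now apply Cmod_pos_of_Re. Qed.

(** The upper bound is exp (-a) >= 1 - a read as exp a <= 1 / (1 - a); the excess a^2 / (1 - a) is
    at most 2 a^2 for a <= 1/2. *)
Lemma exp_sub_affine (a : R) : a <= 1 / 2 -> 0 <= exp a - 1 - a <= 2 * a ^ 2.
Proof.
intros Ha. split; [pose proof (exp_ineq1_le a); lra|].
pose proof (exp_ineq1_le (- a)) as H. rewrite exp_Ropp in H.
pose proof (exp_pos a) as P.
apply (Rmult_le_compat_r (exp a)) in H; [|lra]. rewrite Rinv_l in H by lra.
nra.
Qed.

Lemma abs_sin_le (x : R) : Rabs (sin x) <= Rabs x.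
Proof.
assert (P : forall y, 0 <= y -> Rabs (sin y) <= y).
{ intros y [Hy|<-]; [|rewrite sin_0, Rabs_R0; lra].
  pose proof (sin_lt_x y Hy). pose proof PI2_3_2. pose proof (SIN_bound y).
  apply Rabs_le. split; [|lra].
  destruct (Rle_dec y PI) as [h|h]; [pose proof (sin_ge_0 y); lra|lra]. }
destruct (Rle_dec 0 x) as [h|h].
- rewrite (Rabs_right x) by lra. now apply P.
- rewrite (Rabs_left x) by lra. rewrite <- Rabs_Ropp, <- sin_neg. apply P; lra.
Qed.

Lemma cos_ge_parabola (b : R) : 1 - b ^ 2 / 2 <= cos b.
Proof.
replace b with (2 * (b / 2)) at 2 by field. rewrite cos_2a_sin.
pose proof (abs_sin_le (b / 2)) as H. apply Rsqr_le_abs_1 in H. unfold Rsqr in H.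
nra.
Qed.

Lemma sin_MVT (b : R) : exists c, Rabs c <= Rabs b /\ sin b = cos c * b /\ 0 <= b * c.
Proof.
destruct (MVT_gen sin 0 b cos) as [c [Hc E]].
- intros x _. apply is_derive_Reals, derivable_pt_lim_sin.
- intros x _. apply continuity_sin.
- rewrite sin_0, !Rminus_0_r in E. exists c.
  unfold Rmin, Rmax in Hc. destruct (Rle_dec 0 b).
  + repeat split; [|lra|nra]. rewrite !Rabs_right; lra.
  + repeat split; [|lra|nra]. rewrite !Rabs_left1; lra.
Qed.

Lemma sin_sub_id (b : R) : Rabs b <= 1 -> Rabs (sin b - b) <= b ^ 2.
Proof.
intros Hb. destruct (sin_MVT b) as [c [Hc [-> _]]].
replace (cos c * b - b) with (b * (cos c - 1)) by ring. rewrite Rabs_mult, <- (pow2_abs b).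
pose proof (cos_ge_parabola c) as H. pose proof (COS_bound c).
rewrite <- (pow2_abs c) in H. pose proof (Rabs_pos c). pose proof (Rabs_pos b).
assert (Rabs (cos c - 1) <= Rabs b) by (apply Rabs_le; nra).
nra.
Qed.

Lemma Cexp_plus (z w : C) : Cexp (z + w) = (Cexp z * Cexp w)%C.
Proof.
destruct z, w. unfold Cexp. apply C_eq; simpl; rewrite exp_plus; rewrite ?cos_plus, ?sin_plus; ring.
Qed.

Lemma Cexp_0 : Cexp 0 = 1%C.
Proof. unfold Cexp; simpl. rewrite exp_0, cos_0, sin_0. apply C_eq; simpl; ring. Qed.

Lemma Cexp_opp_mult (z : C) : (Cexp (- z) * Cexp z)%C = 1%C.
Proof. rewrite <- Cexp_plus. replace (- z + z)%C with (RtoC 0) by ring. apply Cexp_0. Qed.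

Lemma Cmod_Cexp (z : C) : Cmod (Cexp z) = exp (Re z).
Proof.
pose proof (exp_pos (Re z)). unfold Cmod, Cexp, fst, snd.
replace (_ + _) with ((exp (Re z)) ^ 2 * ((sin (Im z))² + (cos (Im z))²)) by (unfold Rsqr; ring).
rewrite sin2_cos2, Rmult_1_r. apply sqrt_pow2; lra.
Qed.

Lemma Cexp_neq0 (z : C) : Cexp z <> 0%C.
Proof. apply Cmod_gt_0. rewrite Cmod_Cexp. apply exp_pos. Qed.

Lemma Cexp_sub_affine (h : C) : Cmod h <= 1 / 2 ->
  Cmod (Cexp h - 1 - h) <= 5 * Cmod h ^ 2.
Proof.
intros Hh. rewrite Cmod2_alt. eapply Rle_trans; [apply Cmod_le_sum|].
pose proof (re_le_Cmod h) as Ha. pose proof (im_le_Cmod h) as Hb.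
destruct h as [a b]. unfold Cexp. simpl in *.
pose proof (exp_sub_affine a) as E.
assert (a <= 1/2) by (pose proof (Rle_abs a); lra). specialize (E H).
pose proof (exp_pos a). pose proof (cos_ge_parabola b). pose proof (COS_bound b).
assert (Hs : Rabs (sin b - b) <= b ^ 2) by (apply sin_sub_id; lra).
assert (Rabs a <= 1 / 2) by lra. apply Rabs_le_between in H3.
assert (exp a <= 2) by nra.
assert (A : Rabs (exp a * cos b + - (1) + - a) <= 2 * a ^ 2 + b ^ 2).
{ apply Rabs_le. nra. }
assert (B : Rabs (exp a * sin b + - 0 + - b) <= 2 * b ^ 2 + (a ^ 2 + b ^ 2)).
{ replace (exp a * sin b + - 0 + - b) with (exp a * (sin b - b) + (exp a - 1) * b) by ring.
  eapply Rle_trans; [apply Rabs_triang|]. apply Rplus_le_compat.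
  - rewrite Rabs_mult, (Rabs_right (exp a)) by lra. pose proof (Rabs_pos (sin b - b)). nra.
  - rewrite Rabs_mult.
    assert (Rabs (exp a - 1) <= 2 * Rabs a).
    { apply Rabs_le. pose proof (Rabs_pos a). pose proof (Rle_abs a).
      pose proof (Rle_abs (- a)). rewrite Rabs_Ropp in *. pose proof (pow2_abs a).
      assert (a ^ 2 <= Rabs a * (1 / 2)) by nra. lra. }
    rewrite <- (pow2_abs a), <- (pow2_abs b).
 apply Rle_trans with (2 * Rabs a * Rabs b).
    { apply Rmult_le_compat_r; [apply Rabs_pos|lra]. }
    pose proof (pow2_ge_0 (Rabs a - Rabs b)). lra. }
simpl in A, B. lra.
Qed.

Lemma cder_Cexp (z : C) : cder Cexp z (Cexp z).
Proof.
assert (H0 : cder Cexp 0 1).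
{ apply cder_eps. intros eps He. exists (Rmin (1/2) (eps / 5)). split.
  { apply Rmin_pos; lra. }
  intros w Hw.
  assert (W1 : Cmod (w - 0) < 1/2) by (eapply Rlt_le_trans; [exact Hw|apply Rmin_l]).
  assert (W2 : Cmod (w - 0) < eps / 5) by (eapply Rlt_le_trans; [exact Hw|apply Rmin_r]).
  replace (w - 0)%C with w in * by ring. rewrite Cexp_0.
  replace (Cexp w - 1 - 1 * w)%C with (Cexp w - 1 - w)%C by ring.
  eapply Rle_trans; [apply Cexp_sub_affine; lra|].
  pose proof (Cmod_ge_0 w). nra. }
apply (cder_ext_loc (fun w => (Cexp z * Cexp (w + - z))%C) _ _ _ 1 Rlt_0_1).
- intros w _. rewrite <- Cexp_plus. f_equal. ring.
- eapply cder_eq.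
  + apply cder_scal. apply (cder_comp Cexp (fun w => (w + - z)%C) z 1 (1 + 0)).
    * replace (z + - z)%C with (RtoC 0) by ring. exact H0.
    * apply cder_plus; [apply cder_id|apply cder_const].
  + ring.
Qed.

Lemma hol2_Cexp U : hol2 U Cexp.
Proof. exists Cexp, Cexp. intros; split; apply cder_Cexp. Qed.

Lemma Re_div_Cmod_bound (z : C) : z <> 0%C -> -1 <= Re z / Cmod z <= 1.
Proof.
intros Hz. apply Cmod_gt_0 in Hz. pose proof (re_le_Cmod z) as H.
apply Rabs_le_between in H.
split; apply Rmult_le_reg_r with (Cmod z); auto; unfold Rdiv; rewrite Rmult_assoc, Rinv_l; lra.
Qed.

Lemma cos_Carg (z : C) : z <> 0%C -> cos (Carg z) = Re z / Cmod z.
Proof.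
intros Hz. pose proof (Re_div_Cmod_bound z Hz).
unfold Carg. destruct (Rle_dec 0 (Im z)); rewrite ?cos_neg; now apply cos_acos.
Qed.

Lemma sin_Carg (z : C) : z <> 0%C -> sin (Carg z) = Im z / Cmod z.
Proof.
intros Hz. pose proof (Re_div_Cmod_bound z Hz).
assert (P : 0 < Cmod z) by now apply Cmod_gt_0.
assert (E : sqrt (1 - (Re z / Cmod z)²) = Rabs (Im z) / Cmod z).
{ replace (1 - (Re z / Cmod z)²) with ((Rabs (Im z) / Cmod z)²).
  - apply sqrt_Rsqr. apply Rmult_le_pos; [apply Rabs_pos|]. left; now apply Rinv_0_lt_compat.
  - pose proof (Cmod2_alt z) as Q. unfold Rsqr.
    replace (Rabs (Im z) / Cmod z * (Rabs (Im z) / Cmod z)) with (Rabs (Im z) ^ 2 / Cmod z ^ 2) by (field; lra).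
    rewrite pow2_abs. replace (Im z ^ 2) with (Cmod z ^ 2 - Re z ^ 2) by lra. field; lra. }
unfold Carg. destruct (Rle_dec 0 (Im z)).
- rewrite sin_acos, E, Rabs_right; auto; lra.
- rewrite sin_neg, sin_acos, E, Rabs_left; auto; [field; lra|lra].
Qed.

Lemma Cexp_Clog (z : C) : z <> 0%C -> Cexp (Clog z) = z.
Proof.
intros Hz. assert (P : 0 < Cmod z) by now apply Cmod_gt_0.
unfold Cexp, Clog; simpl. rewrite exp_ln, cos_Carg, sin_Carg by auto.
apply C_eq; simpl; field; lra.
Qed.

Lemma Clog_Cexp (w : C) : - PI < Im w < PI -> Clog (Cexp w) = w.
Proof.
intros Hw. unfold Clog. rewrite Cmod_Cexp, ln_exp. apply C_eq; [reflexivity|].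
unfold Carg. simpl. rewrite Cmod_Cexp. pose proof (exp_pos (Re w)).
replace (exp (Re w) * cos (Im w) / exp (Re w)) with (cos (Im w)) by (field; lra).
destruct (Rle_dec 0 (exp (Re w) * sin (Im w))) as [h|h].
- apply acos_cos. split; [|lra]. apply Rnot_lt_le. intros K.
  pose proof (sin_lt_0_var (Im w)). nra.
- rewrite <- cos_neg, acos_cos; [ring|].
  split; [|lra]. destruct (Rle_dec 0 (Im w)); [|lra].
  pose proof (sin_ge_0 (Im w)). nra.
Qed.

Definition right_half (z : C) : Prop := 0 < Re z.

Lemma Im_Clog_right (z : C) : right_half z -> - (PI / 2) < Im (Clog z) < PI / 2.
Proof.
intros Hz. pose proof (neq0_of_Re z Hz) as Hn. simpl.
pose proof (Re_div_Cmod_bound z Hn) as B.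
assert (Hc : 0 < Re z / Cmod z) by (apply Rdiv_lt_0_compat; auto; now apply Cmod_gt_0).
pose proof PI_RGT_0.
assert (A : 0 <= acos (Re z / Cmod z) < PI / 2).
{ pose proof (acos_bound (Re z / Cmod z)). split; [lra|].
  apply Rnot_le_lt. intros K.
  pose proof (cos_le_0 (acos (Re z / Cmod z))) as L. rewrite cos_acos in L by auto. lra. }
unfold Carg. destruct (Rle_dec 0 (Im z)); lra.
Qed.

Lemma right_half_Cexp (w : C) : - (PI / 2) < Im w < PI / 2 -> right_half (Cexp w).
Proof.
intros [H1 H2]. unfold right_half; simpl. apply Rmult_lt_0_compat; [apply exp_pos|].
now apply cos_gt_0.
Qed.

Lemma Clog_1 : Clog 1 = 0%C.
Proof. rewrite <- Cexp_0. apply Clog_Cexp. simpl. pose proof PI_RGT_0. lra. Qed.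

Lemma Carg_atan (z : C) : right_half z -> Carg z = atan (Im z / Re z).
Proof.
intros Hz. pose proof (Im_Clog_right z Hz) as H. simpl in H.
pose proof (neq0_of_Re z Hz) as Hn.
assert (P : 0 < Cmod z) by now apply Cmod_gt_0.
rewrite <- (atan_tan (Carg z)) by auto. f_equal. unfold tan.
rewrite sin_Carg, cos_Carg by auto. unfold right_half in Hz. field. lra.
Qed.

Lemma abs_atan_le (x : R) : Rabs (atan x) <= Rabs x.
Proof.
destruct (MVT_gen atan 0 x (fun y => / (1 + y ^ 2))) as [c [_ E]].
- intros y _. apply is_derive_Reals.
  apply derivable_pt_lim_atan.
- intros y _. apply derivable_continuous_pt. apply derivable_pt_atan.
- rewrite atan_0, !Rminus_0_r in E. rewrite E, Rabs_mult.
  assert (0 < / (1 + c ^ 2) <= 1).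
  { pose proof (pow2_ge_0 c). split; [apply Rinv_0_lt_compat; lra|].
    rewrite <- Rinv_1. apply Rinv_le_contravar; lra. }
  pose proof (Rabs_pos x). rewrite (Rabs_right (/ (1 + c ^ 2))) by lra.
  apply Rle_trans with (1 * Rabs x); [apply Rmult_le_compat_r|]; lra.
Qed.

(** The real part uses 1 - 1/r <= ln r <= r - 1, the imaginary part |atan x| <= |x|. This crude
    bound lets the derivative of the logarithm be read off from that of the exponential. *)
Lemma Cmod_Clog_1_plus (h : C) : Cmod h <= 1 / 2 -> Cmod (Clog (1 + h)) <= 4 * Cmod h.
Proof.
intros Hh. pose proof (re_le_Cmod h) as Ha. pose proof (im_le_Cmod h) as Hb.
pose proof (Cmod_ge_0 h).
assert (Hr : 1 / 2 <= Re (1 + h)%C).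
{ apply Rabs_le_between in Ha. destruct h; simpl in *. lra. }
assert (Hm : Rabs (Cmod (1 + h) - 1) <= Cmod h).
{ apply Rabs_le. split.
  - pose proof (Cmod_triangle (1 + h) (- h)) as T. rewrite Cmod_opp in T.
    replace (1 + h + - h)%C with (RtoC 1) in T by ring. rewrite Cmod_1 in T. lra.
  - pose proof (Cmod_triangle 1 h) as T. rewrite Cmod_1 in T. lra. }
eapply Rle_trans; [apply Cmod_le_sum|].
assert (A : Rabs (Re (Clog (1 + h))) <= 2 * Cmod h).
{ simpl. set (r := Cmod (1 + h)) in *. apply Rabs_le_between in Hm.
  assert (0 < r) by lra. assert (1/2 <= r) by lra.
  pose proof (exp_ineq1_le (ln r)) as L1. rewrite exp_ln in L1 by auto.
  pose proof (exp_ineq1_le (- ln r)) as L2. rewrite exp_Ropp, exp_ln in L2 by auto.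
  apply Rabs_le. split; [|lra].
  assert (/ r <= 1 + 2 * Cmod h); [|lra].
  apply Rmult_le_reg_r with r; auto. rewrite Rinv_l by lra. nra. }
assert (B : Rabs (Im (Clog (1 + h))) <= 2 * Cmod h).
{ simpl Im. rewrite Carg_atan by (unfold right_half; lra).
  eapply Rle_trans; [apply abs_atan_le|].
  unfold Rdiv. rewrite Rabs_mult, Rabs_inv.
  replace (Im (1 + h)%C) with (Im h) by (destruct h; simpl; ring).
  rewrite (Rabs_right (Re (1 + h)%C)) by lra.
  assert (0 < / Re (1 + h)%C <= 2).
  { split; [apply Rinv_0_lt_compat; lra|].
    replace 2 with (/ (1 / 2)) by field. apply Rinv_le_contravar; lra. }
  rewrite Rmult_comm. apply Rmult_le_compat; try apply Rabs_pos; lra. }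
lra.
Qed.

(** The point 1 suffices: near z, Clog w = Clog z + Clog (w / z), since both arguments lie in
    (-pi/2, pi/2) and their sum stays where [Clog] inverts [Cexp]. *)
Lemma cder_Clog (z : C) : right_half z -> cder Clog z (/ z).
Proof.
intros Hz. pose proof (neq0_of_Re z Hz) as Hn.
assert (H1 : cder Clog 1 1).
(* The radius 1/8 keeps |Clog (1 + h)| <= 1/2, as [Cexp_sub_affine] requires; 80 is 5 * 4^2. *)
{ apply cder_eps. intros eps He. exists (Rmin (1/8) (eps / 80)). split.
  { apply Rmin_pos; lra. }
  intros w Hw.
  assert (W1 : Cmod (w - 1) < 1/8) by (eapply Rlt_le_trans; [exact Hw|apply Rmin_l]).
  assert (W2 : Cmod (w - 1) < eps / 80) by (eapply Rlt_le_trans; [exact Hw|apply Rmin_r]).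
  set (h := (w - 1)%C) in *. replace w with (1 + h)%C by (unfold h; ring).
  clearbody h. clear w Hw. rewrite Clog_1.
  pose proof (Cmod_Clog_1_plus h) as L. pose proof (Cmod_ge_0 h).
  assert (R1 : (1 + h)%C <> 0%C).
  { apply neq0_of_Re. pose proof (re_le_Cmod h) as Ha. apply Rabs_le_between in Ha.
    rewrite Re_plus. change (Re 1) with 1. lra. }
  pose proof (Cexp_sub_affine (Clog (1 + h))) as E. rewrite Cexp_Clog in E by auto.
  replace (Clog (1 + h) - 0 - 1 * h)%C with (- (1 + h - 1 - Clog (1 + h)))%C by ring.
  rewrite Cmod_opp. eapply Rle_trans; [apply E; lra|].
  pose proof (Cmod_ge_0 (Clog (1 + h))).
  assert (Cmod (Clog (1 + h)) ^ 2 <= (4 * Cmod h) ^ 2) by (apply pow_incr; lra).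
  nra. }
assert (Pz : 0 < Cmod z) by now apply Cmod_gt_0.
apply (cder_ext_loc (fun w => (Clog z + Clog (w * / z))%C) _ _ _ (Cmod z) Pz).
- intros w Hw.
  assert (Hu : right_half (w * / z)).
  { replace (w * / z)%C with (1 + (w - z) * / z)%C by (field; auto).
    assert (K : Cmod ((w - z) * / z) < 1).
    { rewrite Cmod_mult, Cmod_inv by auto. apply Rmult_lt_reg_r with (Cmod z); auto.
      rewrite Rmult_assoc, Rinv_l; lra. }
    pose proof (re_le_Cmod ((w - z) * / z)) as Ha. apply Rabs_le_between in Ha.
    unfold right_half. rewrite Re_plus. change (Re 1) with 1. lra. }
  rewrite <- (Clog_Cexp (Clog z + Clog (w * / z))).
  + rewrite Cexp_plus, !Cexp_Clog; auto.
    * f_equal. field; auto.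
    * now apply neq0_of_Re.
  + pose proof (Im_Clog_right _ Hz). pose proof (Im_Clog_right _ Hu). simpl in *. lra.
- eapply cder_eq.
  + apply cder_plus; [apply cder_const|].
    apply (cder_comp Clog (fun w => (w * / z)%C) z 1 (1 * / z + z * 0)).
    * replace (z * / z)%C with (RtoC 1) by (field; auto). exact H1.
    * apply (cder_mult (fun w => w) (fun _ => (/ z)%C)); [apply cder_id|apply cder_const].
  + ring.
Qed.

Lemma hol2_Clog : hol2 right_half Clog.
Proof.
exists Cinv, (fun z => (- (/ z * / z))%C). intros z Hz. split.
- now apply cder_Clog.
- apply cder_inv. now apply neq0_of_Re.
Qed.

(** * A maximum principle *)

(** If l > 0, then u' - u' t0 has the sign of t - t0 nearby. For u' t0 >= 0 the function u grows
    strictly to the right of t0, otherwise to the left; the case split replaces the proof that u' t0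
    = 0. *)
Lemma second_derivative_local_max (u u' : R -> R) (t0 l d : R) : 0 < d ->
  (forall t, Rabs (t - t0) < d -> is_derive u t (u' t)) ->
  is_derive u' t0 l ->
  (forall t, Rabs (t - t0) < d -> u t <= u t0) -> l <= 0.
Proof.
intros Hd Du Du' Hmax. apply Rnot_lt_le. intros Hl.
apply is_derive_Reals in Du'. destruct (Du' l Hl) as [e He].
assert (mono : forall h, h <> 0 -> Rabs h < e -> 0 < (u' (t0 + h) - u' t0) / h).
{ intros h h0 hh. specialize (He h h0 hh). apply Rabs_def2 in He. lra. }
pose proof (cond_pos e) as Pe.
set (q := Rmin d e / 2).
assert (q < d /\ q < e /\ 0 < q) as [q1 [q2 q3]].
{ unfold q. pose proof (Rmin_l d e). pose proof (Rmin_r d e).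
  assert (0 < Rmin d e) by (apply Rmin_pos; auto). lra. }
destruct (Rle_dec 0 (u' t0)) as [H0|H0].
- destruct (MVT_cor2 u u' t0 (t0 + q)) as [c [E Hc]]; [lra| |].
  { intros c Hc. apply is_derive_Reals, Du. apply Rabs_def1; lra. }
  specialize (mono (c - t0)). replace (t0 + (c - t0)) with c in mono by ring.
  assert (0 < (u' c - u' t0) / (c - t0)) by (apply mono; [lra|apply Rabs_def1; lra]).
  assert (u' c - u' t0 = (u' c - u' t0) / (c - t0) * (c - t0)) by (field; lra).
  assert (0 < u' c) by nra.
  assert (u (t0 + q) <= u t0) by (apply Hmax; apply Rabs_def1; lra). nra.
- destruct (MVT_cor2 u u' (t0 - q) t0) as [c [E Hc]]; [lra| |].
  { intros c Hc. apply is_derive_Reals, Du. apply Rabs_def1; lra. }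
  specialize (mono (c - t0)). replace (t0 + (c - t0)) with c in mono by ring.
  assert (0 < (u' c - u' t0) / (c - t0)) by (apply mono; [lra|apply Rabs_def1; lra]).
  assert (u' c - u' t0 = (u' c - u' t0) / (c - t0) * (c - t0)) by (field; lra).
  assert (u' c < 0) by nra.
  assert (u (t0 - q) <= u t0) by (apply Hmax; apply Rabs_def1; lra). nra.
Qed.

Lemma is_derive_square (f : R -> R) (t l : R) : is_derive f t l ->
  is_derive (fun t => f t ^ 2) t (2 * (f t * l)).
Proof.
intros H. evar_last. apply is_derive_pow, H. simpl. ring.
Qed.

(* [|H|^2] is subharmonic: its Laplacian is [4 |H'|^2]. *)
Lemma no_local_max_perturbed (H : C -> C) (w0 : C) (d eps : R) : 0 < d -> 0 < eps ->
  hol2 (fun w => Cmod (w - w0) < d) H ->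
  ~ (forall w, Cmod (w - w0) < d ->
       Cmod (H w) ^ 2 + eps * Re w ^ 2 <= Cmod (H w0) ^ 2 + eps * Re w0 ^ 2).
Proof.
intros Hd He [H1 [H2 D]] Hmax.
assert (near : forall (e : C) (t : R), Cmod e = 1 -> Rabs (t - 0) < d ->
  Cmod (w0 + t * e - w0) < d).
{ intros e t Ce Ht. replace (w0 + t * e - w0)%C with (t * e)%C by ring.
  rewrite Cmod_mult, Cmod_R, Ce. rewrite Rminus_0_r in Ht. lra. }
assert (key : forall e : C, Cmod e = 1 ->
  2 * (Re (H1 w0 * e) ^ 2 + Im (H1 w0 * e) ^ 2
       + Re (H w0) * Re (H2 w0 * e * e) + Im (H w0) * Im (H2 w0 * e * e))
  + 2 * eps * Re e ^ 2 <= 0).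
{ intros e Ce.
  pose (u := fun t : R => Re (H (w0 + t * e)%C) ^ 2 + Im (H (w0 + t * e)%C) ^ 2
                     + eps * (Re w0 + t * Re e) ^ 2).
  pose (u' := fun t : R =>
     2 * (Re (H (w0 + t * e)%C) * Re (H1 (w0 + t * e) * e)%C)
     + 2 * (Im (H (w0 + t * e)%C) * Im (H1 (w0 + t * e) * e)%C)
     + eps * (2 * (Re w0 + t * Re e) * Re e)).
  assert (E0 : (w0 + 0 * e)%C = w0) by ring.
  apply (second_derivative_local_max u u' 0 _ d Hd).
  - intros t Ht. specialize (D _ (near e t Ce Ht)). destruct D as [D _].
    destruct (cder_line_Re _ _ _ _ _ D) as [A B].
    apply (is_derive_plus (V := R_NormedModule)); [apply (is_derive_plus (V := R_NormedModule))|].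
    + now apply is_derive_square.
    + now apply is_derive_square.
    + auto_derive; auto. ring.
  - assert (Z : Rabs (0 - 0) < d) by (rewrite Rminus_0_r, Rabs_R0; auto).
    pose proof (D _ (near e 0 Ce Z)) as [D1 D2].
    destruct (cder_line_Re _ _ _ _ _ D1) as [A B].
    assert (D2' : cder (fun w => (H1 w * e)%C) (w0 + 0 * e) (H2 (w0 + 0 * e)%C * e)).
    { eapply cder_eq; [apply cder_mult; [exact D2|apply cder_const]|cbv beta; ring]. }
    destruct (cder_line_Re _ _ _ _ _ D2') as [A' B'].
    rewrite E0 in *.
    eapply is_derive_ext; [intros t; unfold u'; reflexivity|].
    evar_last.
    + apply (is_derive_plus (V := R_NormedModule)); [apply (is_derive_plus (V := R_NormedModule))|].
      * apply is_derive_scal. apply (is_derive_mult (K := R_AbsRing)); [exact A|exact A'|exact Rmult_comm].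
      * apply is_derive_scal. apply (is_derive_mult (K := R_AbsRing)); [exact B|exact B'|exact Rmult_comm].
      * instantiate (1 := 2 * eps * Re e ^ 2). auto_derive; auto. ring.
    + unfold plus, mult; simpl. replace (w0 + 0 * e)%C with w0 by ring. unfold Re, Im. ring.
  - intros t Ht. specialize (Hmax _ (near e t Ce Ht)). rewrite !Cmod2_alt in Hmax.
    unfold u. rewrite E0. replace (Re w0 + 0 * Re e) with (Re w0) by ring.
    rewrite Re_plus, Re_mult in Hmax. simpl (Re t) in Hmax. simpl (Im t) in Hmax.
    rewrite Rmult_0_l, Rminus_0_r in Hmax. exact Hmax. }
(* The square of the direction is 1 and then -1, so the terms in [H2] cancel; the sum reads 4 |H1|^2
   + 2 eps <= 0. *)
pose proof (key 1%C Cmod_1) as K1. pose proof (key Ci Cmod_Ci) as K2.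
rewrite !Re_mult, !Im_mult in K1, K2. rewrite ?Re_mult, ?Im_mult in K1, K2.
simpl (Re 1) in *. simpl (Im 1) in *. simpl (Re Ci) in *. simpl (Im Ci) in *.
pose proof (pow2_ge_0 (Re (H1 w0))). pose proof (pow2_ge_0 (Im (H1 w0))).
nra.
Qed.

Lemma list_argmax {A : Type} (P : A -> Prop) (v : A -> R) (l : list A) :
  (exists x, In x l /\ P x) ->
  exists x, In x l /\ P x /\ forall y, In y l -> P y -> v y <= v x.
Proof.
induction l as [|a l IH]; [intros [x [[] _]]|].
intros Hx.
destruct (classic (P a)) as [Pa|Na].
- destruct (classic (exists x, In x l /\ P x)) as [Hl|Hl].
  + destruct (IH Hl) as [x [Ix [Px Mx]]].
    destruct (Rle_dec (v a) (v x)).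
    * exists x. split; [now right|split; auto]. intros y [<-|Iy] Py; auto.
    * exists a. split; [now left|split; auto]. intros y [<-|Iy] Py; [lra|].
      specialize (Mx y Iy Py). lra.
  + exists a. split; [now left|split; auto]. intros y [<-|Iy] Py; [lra|].
    exfalso. apply Hl. eauto.
- destruct IH as [x [Ix [Px Mx]]].
  + destruct Hx as [x [[<-|Ix] Px]]; [contradiction|eauto].
  + exists x. split; [now right|split; auto]. intros y [<-|Iy] Py; [contradiction|auto].
Qed.

(** Without a maximum every point p has a better point q, with U still below U(q) in a neighbourhood
    of p. Finitely many such neighbourhoods cover the rectangle; the best of their points q lies in
    one of them and is beaten by another. *)
Lemma max_on_rectangle (U : R -> R -> R) (a b a' b' : R) : a <= b -> a' <= b' ->
  (forall x y, a <= x <= b -> a' <= y <= b' -> forall eps, 0 < eps ->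
     exists d, 0 < d /\ forall x' y', Rabs (x' - x) < d -> Rabs (y' - y) < d ->
       Rabs (U x' y' - U x y) < eps) ->
  exists x0 y0, a <= x0 <= b /\ a' <= y0 <= b' /\
    forall x y, a <= x <= b -> a' <= y <= b' -> U x y <= U x0 y0.
Proof.
intros Hab Hab' Hc. apply NNPP. intros Hno.
pose (I := fun p : R * R => a <= fst p <= b /\ a' <= snd p <= b').
pose (V := fun p : R * R => U (fst p) (snd p)).
assert (better : forall p, exists qd : (R * R) * posreal, I p ->
   I (fst qd) /\ forall x y, Rabs (x - fst p) < snd qd -> Rabs (y - snd p) < snd qd -> U x y < V (fst qd)).
{ intros [x y]. destruct (classic (I (x, y))) as [Hp|Hp].
  - destruct (classic (exists q, I q /\ V (x, y) < V q)) as [[q [Iq Hq]]|Hn].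
    + destruct Hp as [Hp1 Hp2].
      destruct (Hc x y Hp1 Hp2 (V q - V (x, y))) as [d [Hd K]]; [lra|].
      exists (q, mkposreal d Hd). intros _. split; [exact Iq|]. simpl.
      intros x' y' Hx Hy. specialize (K x' y' Hx Hy). apply Rabs_def2 in K.
      unfold V in *; simpl in *. lra.
    + exfalso. apply Hno. exists x, y. destruct Hp as [Hp1 Hp2].
      split; [exact Hp1|split; [exact Hp2|]].
      intros x' y' Hx Hy. apply Rnot_lt_le. intros Hlt. apply Hn. exists (x', y').
      split; [split; assumption|exact Hlt].
  - exists ((x, y), mkposreal 1 Rlt_0_1). intros; contradiction. }
pose (g := fun p => proj1_sig (constructive_indefinite_description _ (better p))).
assert (Hg : forall p, I p -> I (fst (g p)) /\ forall x y, Rabs (x - fst p) < snd (g p) ->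
  Rabs (y - snd p) < snd (g p) -> U x y < V (fst (g p))).
{ intros p. exact (proj2_sig (constructive_indefinite_description _ (better p))). }
clearbody g.
pose (fl := fun t : Compactness.Tn 2 R => (fst t, fst (snd t)) : R * R).
apply (compactness_list 2 (a, (a', tt)) (b, (b', tt)) (fun t => snd (g (fl t)))).
intros [l Hl].
assert (Hl' : forall p, I p -> exists t, In t l /\ I (fl t) /\ U (fst p) (snd p) < V (fst (g (fl t)))).
{ intros [x y] [Ix Iy].
  destruct (Hl (x, (y, tt))) as [[tx [ty []]] [It [Bt Ct]]].
  { simpl in *. tauto. }
  exists (tx, (ty, tt)). split; [exact It|]. simpl in Bt.
  assert (J : I (fl (tx, (ty, tt)))) by (unfold I, fl; simpl; tauto).
  split; [exact J|]. destruct (Hg _ J) as [_ G]. apply G; simpl in *; tauto. }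
destruct (list_argmax (fun t => I (fl t)) (fun t => V (fst (g (fl t)))) l) as [t [It [Jt Mt]]].
{ destruct (Hl' (a, a')) as [t [It [Jt _]]]; [split; simpl; lra|]. eauto. }
destruct (Hg _ Jt) as [Jg _].
destruct (Hl' _ Jg) as [s [Is [Js Ks]]].
specialize (Mt s Is Js). unfold V in *. lra.
Qed.

(** * The Schwarz lemma *)

(** Its modulus is |phi(z)| / |z|^s at z = e^w. Working with w avoids both the branch of z^s and the
    singularity at 0. For s < 1 the modulus tends to 0 at the far end, which it need not do for s =
    1. *)
Definition log_lift (phi : C -> C) (s : R) (w : C) : C :=
  (phi (Cexp w) * Cexp (- s * w))%C.

Lemma Cmod_log_lift phi s w :
  Cmod (log_lift phi s w) = Cmod (phi (Cexp w)) * exp (- (s * Re w)).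
Proof.
unfold log_lift. rewrite Cmod_mult, Cmod_Cexp. do 2 f_equal. destruct w; simpl; ring.
Qed.

Lemma inD_Cexp (w : C) : Re w < 0 -> inD (Cexp w).
Proof. intros H. unfold inD. rewrite Cmod_Cexp, <- exp_0. now apply exp_increasing. Qed.

Lemma hol2_log_lift phi s : hol2 inD phi -> hol2 (fun w => Re w < 0) (log_lift phi s).
Proof.
intros H. apply hol2_mult.
- apply (hol2_comp _ inD); auto using hol2_Cexp, inD_Cexp.
- apply (hol2_comp _ (fun _ => True)); auto using hol2_Cexp.
  apply hol2_mult; [apply hol2_const|apply hol2_id].
Qed.

Lemma Cexp_periodic (x y : R) : Cexp (x, y + 2 * PI) = Cexp (x, y).
Proof. unfold Cexp; simpl. now rewrite cos_plus, sin_plus, cos_2PI, sin_2PI, !Rmult_0_r, !Rmult_1_r, Rminus_0_r, Rplus_0_r. Qed.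

Lemma Cmod_log_lift_periodic phi s (x y : R) :
  Cmod (log_lift phi s (x, y + 2 * PI)) = Cmod (log_lift phi s (x, y)).
Proof. rewrite !Cmod_log_lift, Cexp_periodic. reflexivity. Qed.

Lemma log_lift_continuous phi s eps x y : hol2 inD phi -> x < 0 ->
  forall e, 0 < e -> exists d, 0 < d /\ forall x' y', Rabs (x' - x) < d -> Rabs (y' - y) < d ->
    Rabs (Cmod (log_lift phi s (x', y')) ^ 2 + eps * x' ^ 2
          - (Cmod (log_lift phi s (x, y)) ^ 2 + eps * x ^ 2)) < e.
Proof.
intros Hphi Hx e He.
destruct (hol2_log_lift phi s Hphi) as [H1 [H2 D]].
destruct (D (x, y) Hx) as [D1 _].
set (H := log_lift phi s) in *.
set (m := Cmod (H (x, y))).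
assert (Hm : 0 <= m) by apply Cmod_ge_0.
pose (k := e / (2 * (2 * m + 1))).
assert (Hk : 0 < k) by (unfold k; apply Rdiv_lt_0_compat; lra).
destruct (cder_continuous _ _ _ D1 (Rmin 1 k)) as [d1 [Hd1 K]]; [apply Rmin_pos; lra|].
pose (k2 := e / (2 * (Rabs eps * (2 * Rabs x + 1) + 1))).
pose proof (Rabs_pos eps). pose proof (Rabs_pos x).
assert (Q0 : 0 <= Rabs eps * (2 * Rabs x + 1)) by (apply Rmult_le_pos; lra).
assert (Hk2 : 0 < k2) by (unfold k2; apply Rdiv_lt_0_compat; lra).
exists (Rmin (d1 / 2) (Rmin 1 k2)). split; [repeat apply Rmin_pos; lra|].
intros x' y' Hx' Hy'.
assert (Hxx : Rabs (x' - x) < d1 / 2 /\ Rabs (x' - x) < 1 /\ Rabs (x' - x) < k2).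
{ repeat split; (eapply Rlt_le_trans; [exact Hx'|]).
  - apply Rmin_l.
  - eapply Rle_trans; [apply Rmin_r|apply Rmin_l].
  - eapply Rle_trans; [apply Rmin_r|apply Rmin_r]. }
assert (Hyy : Rabs (y' - y) < d1 / 2) by (eapply Rlt_le_trans; [exact Hy'|apply Rmin_l]).
assert (Hc : Cmod ((x', y') - (x, y)) < d1).
{ eapply Rle_lt_trans; [apply Cmod_le_sum|]. simpl.
  replace (x' + - x) with (x' - x) by ring. replace (y' + - y) with (y' - y) by ring. lra. }
specialize (K _ Hc).
assert (K1 : Cmod (H (x', y') - H (x, y)) < 1) by (eapply Rlt_le_trans; [exact K|apply Rmin_l]).
assert (K2 : Cmod (H (x', y') - H (x, y)) < k) by (eapply Rlt_le_trans; [exact K|apply Rmin_r]).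
set (m' := Cmod (H (x', y'))).
assert (Dm : Rabs (m' - m) <= Cmod (H (x', y') - H (x, y))).
{ apply Rabs_le. split.
  - pose proof (Cmod_triangle (H (x', y')) (- (H (x', y') - H (x, y)))) as T.
    rewrite Cmod_opp in T.
    replace (H (x', y') + - (H (x', y') - H (x, y)))%C with (H (x, y)) in T by ring.
    fold m m' in T. lra.
  - pose proof (Cmod_triangle (H (x, y)) (H (x', y') - H (x, y))) as T.
    replace (H (x, y) + (H (x', y') - H (x, y)))%C with (H (x', y')) in T by ring.
    fold m m' in T. lra. }
assert (Hm' : 0 <= m') by apply Cmod_ge_0.
replace (m' ^ 2 + eps * x' ^ 2 - (m ^ 2 + eps * x ^ 2))
  with ((m' - m) * (m' + m) + eps * ((x' - x) * (x' + x))) by ring.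
eapply Rle_lt_trans; [apply Rabs_triang|]. rewrite !Rabs_mult.
assert (A : Rabs (m' - m) * Rabs (m' + m) <= k * (2 * m + 1)).
{ apply Rmult_le_compat; try apply Rabs_pos; try lra.
  rewrite Rabs_right by lra. assert (Q1 : Rabs (m' - m) <= 1) by lra.
  apply Rabs_le_between in Q1. lra. }
assert (B : Rabs eps * (Rabs (x' - x) * Rabs (x' + x)) <= k2 * (Rabs eps * (2 * Rabs x + 1))).
{ replace (k2 * (Rabs eps * (2 * Rabs x + 1))) with (Rabs eps * (k2 * (2 * Rabs x + 1))) by ring.
  apply Rmult_le_compat_l; auto.
  apply Rmult_le_compat; try apply Rabs_pos; try lra.
  replace (x' + x) with ((x' - x) + 2 * x) by ring.
  eapply Rle_trans; [apply Rabs_triang|]. rewrite Rabs_mult, (Rabs_right 2); lra. }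
assert (A' : k * (2 * m + 1) = e / 2) by (unfold k; field; lra).
assert (B' : k2 * (Rabs eps * (2 * Rabs x + 1)) < k2 * (Rabs eps * (2 * Rabs x + 1) + 1)) by lra.
replace (k2 * (Rabs eps * (2 * Rabs x + 1) + 1)) with (e / 2) in B' by (unfold k2; field; lra).
lra.
Qed.

(* The maximum principle on a half-strip, where the decay [|H(w)| = O(e^{(1-s) Re w})]
   takes care of the end at minus infinity. *)
Lemma log_lift_bound (phi : C -> C) (M s rho : R) :
  hol2 inD phi -> phi 0 = 0%C -> (forall z, inD z -> Cmod (phi z) <= M) ->
  s < 1 -> rho < 0 ->
  forall w, Re w <= rho -> - PI <= Im w <= PI ->
    Cmod (log_lift phi s w) <= M * exp (- (s * rho)).
Proof.
intros Hphi H0 HM Hs Hrho w Hw Hw'.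
assert (D0 : exists l, cder phi 0 l).
{ apply (hol2_cder _ _ Hphi). unfold inD. rewrite Cmod_0. lra. }
destruct D0 as [l D0]. destruct (cder_local_lipschitz _ _ _ D0) as [d0 [Hd0 Lip]].
set (c := Cmod l + 1) in *. assert (Hc : 1 <= c) by (pose proof (Cmod_ge_0 l); unfold c; lra).
assert (M0 : 0 <= M).
{ eapply Rle_trans; [apply (Cmod_ge_0 (phi 0))|]. apply HM. unfold inD. rewrite Cmod_0. lra. }
set (K := M * exp (- (s * rho))).
assert (K0 : 0 <= K) by (apply Rmult_le_pos; [auto|left; apply exp_pos]).
apply Rnot_lt_le. intros Hlt.
set (H := log_lift phi s) in *.
assert (edge : forall y, Cmod (H (rho, y)) <= K).
{ intros y. unfold H, K. rewrite Cmod_log_lift. simpl.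
  apply Rmult_le_compat_r; [left; apply exp_pos|]. apply HM. now apply inD_Cexp. }
set (D := Cmod (H w) ^ 2 - K ^ 2).
assert (HD : 0 < D) by (unfold D; nra).
(* Each summand has a task: the edge -L lies to the left of w, e^(-L) is below the Lipschitz radius
   [d0], and c^2 e^(-2 L (1 - s)) <= D / 2, the last from e^X >= X. *)
set (L := 1 - Re w + Rabs (ln d0) + c ^ 2 / (D * (1 - s))).
assert (HcD : 0 < c ^ 2 / (D * (1 - s))).
{ apply Rdiv_lt_0_compat; [nra|apply Rmult_lt_0_compat; lra]. }
pose proof (Rabs_pos (ln d0)).
assert (HL1 : - L < Re w) by (unfold L; lra).
assert (far : forall y, Cmod (H (- L, y)) ^ 2 <= D / 2).
{ intros y. unfold H. rewrite Cmod_log_lift. simpl (Re _).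
  assert (Hz : Cmod (Cexp (- L, y)) < d0).
  { rewrite Cmod_Cexp. simpl. rewrite <- (exp_ln d0) by auto. apply exp_increasing.
    pose proof (Rle_abs (- ln d0)). rewrite Rabs_Ropp in *. unfold L; lra. }
  pose proof (Lip (Cexp (- L, y))) as P. rewrite H0 in P.
  replace (Cexp (- L, y)%R - 0)%C with (Cexp (- L, y)) in P by ring.
  replace (phi (Cexp (- L, y)%R) - 0)%C with (phi (Cexp (- L, y))) in P by ring.
  specialize (P Hz). rewrite Cmod_Cexp in P. simpl (Re _) in P.
  apply Rle_trans with ((c * exp (- L) * exp (- (s * - L))) ^ 2).
  { apply pow_incr. split.
    - apply Rmult_le_pos; [apply Cmod_ge_0|left; apply exp_pos].
    - apply Rmult_le_compat_r; [left; apply exp_pos|exact P]. }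
  rewrite Rmult_assoc, <- exp_plus.
  replace (- L + - (s * - L)) with (- (L * (1 - s))) by ring.
  set (X := L * (1 - s)).
  assert (HX : c ^ 2 / D <= X).
  { unfold X. apply Rle_trans with (c ^ 2 / (D * (1 - s)) * (1 - s)).
    - right; field; split; lra.
    - apply Rmult_le_compat_r; [lra|]. unfold L. lra. }
  assert (HcD' : 0 < c ^ 2 / D) by (apply Rdiv_lt_0_compat; [nra|lra]).
  pose proof (exp_ineq1_le (2 * X)) as E.
  replace ((c * exp (- X)) ^ 2) with (c ^ 2 * / exp (2 * X)).
  2:{ rewrite <- exp_Ropp. replace (- (2 * X)) with (- X + - X) by ring. rewrite exp_plus. ring. }
  apply Rle_trans with (c ^ 2 * / (2 * (c ^ 2 / D))).
  - apply Rmult_le_compat_l; [nra|]. apply Rinv_le_contravar; lra.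
  - right. field. split; lra. }
(* The perturbation is then at most D / 4 on the rectangle: both vertical edges stay below K^2 + D,
   a value already reached at w. *)
set (eps := D / (4 * L ^ 2)).
assert (HLrho : - L < rho) by lra.
assert (L2 : 0 < L ^ 2) by nra.
assert (Heps : 0 < eps) by (apply Rdiv_lt_0_compat; lra).
assert (HepsL : eps * L ^ 2 = D / 4) by (unfold eps; field; nra).
pose proof PI_RGT_0 as Ppi.
destruct (max_on_rectangle (fun x y => Cmod (H (x, y)) ^ 2 + eps * x ^ 2) (- L) rho (- PI) PI)
  as [x0 [y0 [Hx0 [Hy0 Hmax]]]]; try lra.
{ intros x y Hx _. apply log_lift_continuous; auto. lra. }
assert (Hw0 := Hmax (Re w) (Im w) (conj (Rlt_le _ _ HL1) Hw) Hw').
replace (Re w, Im w) with w in Hw0 by (destruct w; reflexivity).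
pose proof (pow2_ge_0 (Re w)).
assert (Hbig : K ^ 2 + D <= Cmod (H (x0, y0)) ^ 2 + eps * x0 ^ 2) by (unfold D; nra).
assert (Hx2 : eps * x0 ^ 2 <= D / 4).
{ rewrite <- HepsL. apply Rmult_le_compat_l; [lra|nra]. }
assert (- L < x0).
{ destruct Hx0 as [[h|h] _]; auto. subst x0. specialize (far y0). nra. }
assert (x0 < rho).
{ destruct Hx0 as [_ [h|h]]; auto. subst x0. specialize (edge y0).
  pose proof (Cmod_ge_0 (H (rho, y0))). nra. }
(* The disc stays between the vertical edges. The horizontal edges are no boundary: as d <= PI, a
   point beyond them returns after one period, with the same modulus. *)
set (d := Rmin PI (Rmin (x0 + L) (rho - x0))).
assert (Hd : 0 < d) by (repeat apply Rmin_pos; lra).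
assert (d1 : d <= PI) by apply Rmin_l.
assert (d2 : d <= x0 + L) by (eapply Rle_trans; [apply Rmin_r|apply Rmin_l]).
assert (d3 : d <= rho - x0) by (eapply Rle_trans; [apply Rmin_r|apply Rmin_r]).
assert (near : forall v : C, Cmod (v - (x0, y0)) < d -> Rabs (Re v - x0) < d /\ Rabs (Im v - y0) < d).
{ intros v Hv. split; eapply Rle_lt_trans; [|exact Hv| |exact Hv].
  - pose proof (re_le_Cmod (v - (x0, y0))) as T. destruct v; exact T.
  - pose proof (im_le_Cmod (v - (x0, y0))) as T. destruct v; exact T. }
apply (no_local_max_perturbed H (x0, y0) d eps Hd Heps).
- apply hol2_sub with (fun v => Re v < 0); [|now apply hol2_log_lift].
  intros v Hv. destruct (near v Hv) as [T _]. apply Rabs_def2 in T. lra.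
- intros v Hv. destruct (near v Hv) as [T1 T2]. apply Rabs_def2 in T1. apply Rabs_def2 in T2.
  simpl (Re (x0, y0)). destruct v as [x y]. simpl Re in *. simpl Im in *.
  destruct (Rlt_le_dec y (- PI)) as [h|h]; [|destruct (Rle_lt_dec y PI) as [h'|h']].
  + unfold H at 1. rewrite <- Cmod_log_lift_periodic. apply Hmax; lra.
  + apply Hmax; lra.
  + replace y with ((y - 2 * PI) + 2 * PI) by ring.
    unfold H at 1. rewrite Cmod_log_lift_periodic. apply Hmax; lra.
Qed.

Lemma Carg_bound (z : C) : - PI <= Carg z <= PI.
Proof.
unfold Carg. pose proof (acos_bound (Re z / Cmod z)). pose proof PI_RGT_0.
destruct (Rle_dec 0 (Im z)); lra.
Qed.

Lemma schwarz (phi : C -> C) (M : R) :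
  hol2 inD phi -> phi 0 = 0%C -> (forall z, inD z -> Cmod (phi z) <= M) ->
  forall z, inD z -> Cmod (phi z) <= M * Cmod z.
Proof.
intros Hphi H0 HM z Hz.
destruct (Ceq_dec z 0) as [->|Hn].
{ rewrite H0, Cmod_0. lra. }
assert (Pz : 0 < Cmod z) by now apply Cmod_gt_0.
assert (M0 : 0 <= M).
{ eapply Rle_trans; [apply (Cmod_ge_0 (phi 0))|]. apply HM. unfold inD. rewrite Cmod_0. lra. }
set (x := ln (Cmod z)).
assert (Hx : x < 0) by (unfold x; rewrite <- ln_1; now apply ln_increasing).
assert (bound : forall tau, 0 < tau -> Cmod (phi z) <= M * Cmod z * exp tau).
{ intros tau Htau.
  (* The error factor e^tau is shared out: the exponent s = 1 - dl costs dl |x| = tau / 2, and the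
     edge [rho] < 0 costs at most tau / 2. The maximum with x in [rho] keeps ln |z| to the left of
     that edge. *)
  pose (dl := tau / (2 * (- x))).
  assert (Hdl : 0 < dl) by (apply Rdiv_lt_0_compat; lra).
  pose (rho := Rmax x (- tau / (2 * (1 + Rabs (1 - dl))))).
  pose proof (Rabs_pos (1 - dl)).
  assert (Hr : 0 < tau / (2 * (1 + Rabs (1 - dl)))) by (apply Rdiv_lt_0_compat; lra).
  assert (Hrho : rho < 0).
  { unfold rho. apply Rmax_lub_lt; auto. unfold Rdiv in *. rewrite Ropp_mult_distr_l_reverse. lra. }
  pose proof (log_lift_bound phi M (1 - dl) rho Hphi H0 HM) as B.
  specialize (B ltac:(lra) Hrho (Clog z) (Rmax_l _ _) (Carg_bound z)).
  rewrite Cmod_log_lift, Cexp_Clog in B by auto. simpl (Re (Clog z)) in B. fold x in B.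
  apply (Rmult_le_compat_r (exp ((1 - dl) * x))) in B; [|left; apply exp_pos].
  rewrite Rmult_assoc, <- exp_plus, Rplus_opp_l, exp_0, Rmult_1_r in B.
  eapply Rle_trans; [exact B|]. rewrite !Rmult_assoc. apply Rmult_le_compat_l; auto.
  replace (Cmod z) with (exp x) by (unfold x; now apply exp_ln).
  rewrite <- !exp_plus.
  assert (E : - ((1 - dl) * rho) + (1 - dl) * x <= x + tau).
  { assert (dl * (- x) = tau / 2) by (unfold dl; field; lra).
    assert (- ((1 - dl) * rho) <= tau / 2); [|lra].
    assert (- rho <= tau / (2 * (1 + Rabs (1 - dl)))).
    { pose proof (Rmax_r x (- tau / (2 * (1 + Rabs (1 - dl))))) as T. fold rho in T.
      unfold Rdiv in *. rewrite Ropp_mult_distr_l_reverse in T. lra. }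
    apply Rle_trans with (Rabs (1 - dl) * (- rho)).
    - pose proof (Rle_abs (1 - dl)). nra.
    - apply Rle_trans with ((1 + Rabs (1 - dl)) * (tau / (2 * (1 + Rabs (1 - dl))))).
      + apply Rmult_le_compat; lra.
      + right; field. lra. }
  destruct E as [E|E]; [left; now apply exp_increasing|right; now rewrite E]. }
apply Rnot_lt_le. intros Hlt.
pose proof (Cmod_ge_0 (phi z)).
set (A := M * Cmod z) in *.
assert (HA : 0 <= A) by (apply Rmult_le_pos; lra).
pose (e := (Cmod (phi z) - A) / (2 * (A + 1))).
assert (He : 0 < e) by (apply Rdiv_lt_0_compat; lra).
specialize (bound (ln (1 + e))). rewrite exp_ln in bound by lra.
assert (0 < ln (1 + e)) by (rewrite <- ln_1; apply ln_increasing; lra).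
specialize (bound H1).
assert ((A + 1) * e = (Cmod (phi z) - A) / 2) by (unfold e; field; lra).
nra.
Qed.

(** * Complex power series *)

Definition power_series_on_D (b : nat -> C) (F : C -> C) : Prop :=
  forall z, inD z -> @is_pseries C_AbsRing C_NormedModule b z (F z).

Lemma pow_n_Cpow (z : C) (n : nat) : @pow_n C_Ring z n = (z ^ n)%C.
Proof. induction n as [|n IH]; [reflexivity|]. rewrite Cpow_S, <- IH. reflexivity. Qed.

Lemma power_series_term_bounded b F (rho : R) : power_series_on_D b F -> 0 <= rho < 1 ->
  exists M, forall n, Cmod (b n) * rho ^ n <= M.
Proof.
intros HF Hr.
assert (Hz : inD rho) by (unfold inD; rewrite Cmod_R, Rabs_right; lra).
assert (E : ex_series (V := C_CompleteNormedModule)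
   (fun k => @scal C_AbsRing C_CompleteNormedModule (@pow_n C_Ring (RtoC rho) k) (b k))) by (eexists; apply (HF _ Hz)).
apply Cauchy_ex_series in E. destruct (E (mkposreal 1 Rlt_0_1)) as [N HN].
assert (T : forall n, (N <= n)%nat -> Cmod (b n) * rho ^ n <= 1).
{ intros n Hn. specialize (HN n n Hn Hn). rewrite sum_n_n in HN.
  left. eapply Rle_lt_trans; [|exact HN].
  change (Cmod (b n) * rho ^ n <= Cmod (@pow_n C_Ring (RtoC rho) n * b n)).
  rewrite Cmod_mult, pow_n_Cpow, Cmod_pow, Cmod_R, Rabs_right by lra. lra. }
assert (I : exists M, forall n, (n < N)%nat -> Cmod (b n) * rho ^ n <= M).
{ clear. induction N as [|N [M IH]]; [exists 0; intros; lia|].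
  exists (Rmax M (Cmod (b N) * rho ^ N)). intros n Hn.
  destruct (Nat.eq_dec n N) as [->|]; [apply Rmax_r|].
  eapply Rle_trans; [apply IH; lia|apply Rmax_l]. }
destruct I as [M HM]. exists (Rmax M 1). intros n.
destruct (Nat.lt_ge_cases n N).
- eapply Rle_trans; [now apply HM|apply Rmax_l].
- eapply Rle_trans; [now apply T|apply Rmax_r].
Qed.

(** Passing to the moduli makes the radius of convergence of real power series available, together
    with its invariance under differentiation. Boundedness of the terms at the midpoint of r and 1
    puts r strictly inside. *)
Lemma CV_radius_Cmod b F (r : R) : power_series_on_D b F -> 0 <= r < 1 ->
  Rbar_lt (Rabs r) (CV_radius (fun n => Cmod (b n))).
Proof.
intros HF Hr.
apply Rbar_lt_le_trans with ((r + 1) / 2); [simpl; rewrite Rabs_right; lra|].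
apply (proj1 (CV_radius_bounded (fun n => Cmod (b n)))).
destruct (power_series_term_bounded b F ((r + 1) / 2) HF) as [M HM]; [lra|].
exists M. intros n. rewrite Rabs_right; auto.
apply Rle_ge, Rmult_le_pos; [apply Cmod_ge_0|apply pow_le; lra].
Qed.

Lemma ex_series_Cmod_derivatives b F (r : R) : power_series_on_D b F -> 0 <= r < 1 ->
  ex_series (fun n => INR (S n) * Cmod (b (S n)) * r ^ n) /\
  ex_series (fun n => INR (S n) * INR (S (S n)) * Cmod (b (S (S n))) * r ^ n).
Proof.
intros HF Hr. pose proof (CV_radius_Cmod b F r HF Hr) as H. split.
- rewrite <- CV_radius_derive in H. apply CV_disk_inside in H.
  eapply ex_series_ext; [|exact H]. intros n. unfold PS_derive.
  apply Rabs_right, Rle_ge. apply Rmult_le_pos; [|apply pow_le; lra].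
  apply Rmult_le_pos; [apply pos_INR|apply Cmod_ge_0].
- rewrite <- CV_radius_derive, <- CV_radius_derive in H. apply CV_disk_inside in H.
  eapply ex_series_ext; [|exact H]. intros n. unfold PS_derive.
  rewrite <- Rmult_assoc.
  apply Rabs_right, Rle_ge. apply Rmult_le_pos; [|apply pow_le; lra].
  apply Rmult_le_pos; [|apply Cmod_ge_0]. apply Rmult_le_pos; apply pos_INR.
Qed.

Definition derived_coef (b : nat -> C) (n : nat) : C := (INR (S n) * b (S n))%C.

Lemma derived_series_exists b F : power_series_on_D b F ->
  exists F1, power_series_on_D (derived_coef b) F1.
Proof.
intros HF.
assert (E : forall z, exists l : C, inD z ->
   @is_pseries C_AbsRing C_NormedModule (derived_coef b) z l).
{ intros z. destruct (classic (inD z)) as [Hz|Hz]; [|exists (RtoC 0); intros; contradiction].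
  destruct (ex_series_Cmod_derivatives b F (Cmod z) HF) as [S1 _].
  { split; [apply Cmod_ge_0|exact Hz]. }
  destruct (ex_series_le (K := C_AbsRing) (V := C_CompleteNormedModule)
     (fun k => @scal C_AbsRing C_CompleteNormedModule (@pow_n C_Ring z k) (derived_coef b k))
     (fun n => INR (S n) * Cmod (b (S n)) * Cmod z ^ n)) as [l Hl].
  - intros n. change (Cmod (@pow_n C_Ring z n * derived_coef b n) <= INR (S n) * Cmod (b (S n)) * Cmod z ^ n).
    unfold derived_coef.
    rewrite pow_n_Cpow, !Cmod_mult, Cmod_pow, Cmod_R, Rabs_right; [lra|].
    apply Rle_ge, pos_INR.
  - exact S1.
  - exists l. intros _. exact Hl. }
exists (fun z => proj1_sig (constructive_indefinite_description _ (E z))).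
intros z. exact (proj2_sig (constructive_indefinite_description _ (E z))).
Qed.

(** By induction: the remainder for n + 1 is w times the one for n plus n z^(n-1) (w - z)^2. The
    truncated exponents are harmless, since both sides vanish for n = 0 and n = 1. *)
Lemma pow_second_order (z w : C) (r : R) (n : nat) : Cmod z <= r -> Cmod w <= r ->
  Cmod (w ^ n - z ^ n - INR n * z ^ (n - 1) * (w - z))
    <= INR n * INR (n - 1) * r ^ (n - 2) * Cmod (w - z) ^ 2.
Proof.
intros Hz Hw. pose proof (Cmod_ge_0 z) as Pz. pose proof (Cmod_ge_0 w) as Pw.
pose proof (pow2_ge_0 (Cmod (w - z))) as P2.
induction n as [|n IH].
{ simpl. replace (1 - 1 - 0 * 1 * (w - z))%C with (RtoC 0) by ring. rewrite Cmod_0. lra. }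
destruct n as [|n].
{ simpl. replace (w * 1 - z * 1 - 1 * 1 * (w - z))%C with (RtoC 0) by ring. rewrite Cmod_0. lra. }
replace (S (S n) - 1)%nat with (S n) by lia. replace (S (S n) - 2)%nat with n by lia.
replace (S n - 1)%nat with n in IH by lia.
replace (w ^ S (S n) - z ^ S (S n) - INR (S (S n)) * z ^ S n * (w - z))%C
  with (w * (w ^ S n - z ^ S n - INR (S n) * z ^ n * (w - z))
        + INR (S n) * z ^ n * ((w - z) * (w - z)))%C.
2:{ rewrite (S_INR (S n)), RtoC_plus, !Cpow_S. ring. }
eapply Rle_trans; [apply Cmod_triangle|].
rewrite !Cmod_mult, Cmod_pow, Cmod_R, (Rabs_right (INR (S n))) by apply Rle_ge, pos_INR.
set (h := Cmod (w - z)) in *.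
assert (Pr : 0 <= r ^ n) by (apply pow_le; lra).
assert (Pn : 0 <= INR n) by apply pos_INR.
assert (A : Cmod w * Cmod (w ^ S n - z ^ S n - INR (S n) * z ^ n * (w - z))
   <= INR (S n) * INR n * r ^ n * h ^ 2).
{ apply Rle_trans with (r * (INR (S n) * INR n * r ^ (S n - 2) * h ^ 2)).
  - apply Rmult_le_compat; auto. apply Cmod_ge_0.
  - destruct n as [|n]; [simpl; lra|]. replace (S (S n) - 2)%nat with n by lia.
    simpl (r ^ S n). right; ring. }
assert (B : INR (S n) * Cmod z ^ n * (h * h) <= INR (S n) * r ^ n * h ^ 2).
{ replace (h ^ 2) with (h * h) by ring. apply Rmult_le_compat_r; [nra|].
  apply Rmult_le_compat_l; [apply pos_INR|]. apply pow_incr. lra. }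
rewrite !S_INR in *.
assert (0 <= (INR n + 1) * r ^ n * h ^ 2) by (apply Rmult_le_pos; [apply Rmult_le_pos; lra|exact P2]).
nra.
Qed.

Lemma norm_series_le (e : nat -> C) (c : nat -> R) (l : C) (S : R) :
  @is_series C_AbsRing C_NormedModule e l -> is_series c S ->
  (forall n, Cmod (e n) <= c n) -> Cmod l <= S.
Proof.
intros He Hc H.
apply (is_lim_seq_le (fun N => Cmod (@sum_n C_AbelianGroup e N)) (fun N => sum_n c N) (Cmod l) S).
- intros N. eapply Rle_trans; [apply (@norm_sum_n_m C_AbsRing C_NormedModule)|].
  apply sum_n_m_le. exact H.
- exact (filterlim_comp _ _ _ _ _ _ _ _ He (@filterlim_norm C_AbsRing C_NormedModule l)).
- exact Hc.
Qed.

(** No uniform convergence is involved: the first-order remainder of F is dominated termwise, hence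
    is at most S |w - z|^2, where S sums the moduli of the second-derivative series at a radius r
    halfway between |z| and 1. *)
Lemma power_series_cder b F F1 :
  power_series_on_D b F -> power_series_on_D (derived_coef b) F1 ->
  forall z, inD z -> cder F z (F1 z).
Proof.
intros HF HF1 z Hz. pose proof (Cmod_ge_0 z) as Pz. unfold inD in Hz.
set (r := (Cmod z + 1) / 2).
destruct (ex_series_Cmod_derivatives b F r HF) as [_ [S HS]]; [unfold r; lra|].
assert (S0 : 0 <= S).
{ apply (is_lim_seq_le (fun _ => 0) _ 0 S) with (2 := is_lim_seq_const 0) (3 := HS).
  assert (T : forall n, 0 <= INR (Datatypes.S n) * INR (Datatypes.S (Datatypes.S n))
     * Cmod (b (Datatypes.S (Datatypes.S n))) * r ^ n).
  { intros n. apply Rmult_le_pos; [|apply pow_le; unfold r; lra].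
    apply Rmult_le_pos; [|apply Cmod_ge_0]. apply Rmult_le_pos; apply pos_INR. }
  intros N. induction N as [|N IH].
  - rewrite sum_O. apply T.
  - rewrite sum_Sn. apply Rplus_le_le_0_compat; auto. }
assert (key : forall w, Cmod (w - z) < r - Cmod z ->
  Cmod (F w - F z - F1 z * (w - z)) <= S * Cmod (w - z) ^ 2).
{ intros w Hw.
  assert (Hwr : Cmod w <= r).
  { replace w with (z + (w - z))%C by ring. eapply Rle_trans; [apply Cmod_triangle|]. lra. }
  assert (HwD : inD w) by (unfold inD, r in *; lra).
  set (h := (w - z)%C) in *.
  set (e := fun k : nat => ((w ^ k - z ^ k - INR k * z ^ (k - 1) * h) * b k)%C).
  apply (norm_series_le e
    (fun k => INR k * INR (k - 1) * r ^ (k - 2) * Cmod h ^ 2 * Cmod (b k))).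
  (* The derived series is reindexed to match the terms of F; the new term at k = 0 has the factor
     [INR 0], so its truncated exponent does not matter. *)
  - assert (G : @is_series C_AbsRing C_NormedModule
         (fun k => (INR k * z ^ (k - 1) * b k)%C) (F1 z)).
    { apply (@is_series_decr_1 C_AbsRing C_NormedModule).
      match goal with |- is_series _ ?x => replace x with (F1 z) end.
      2:{ change (F1 z = F1 z + - (0 * z ^ 0 * b 0%nat))%C. simpl. ring. }
      eapply (@is_series_ext C_AbsRing C_NormedModule); [|exact (HF1 z Hz)].
      intros n. rewrite pow_n_Cpow.
      change ((z ^ n * derived_coef b n)%C = (INR (Datatypes.S n) * z ^ (Datatypes.S n - 1) * b (Datatypes.S n))%C).
      unfold derived_coef. replace (Datatypes.S n - 1)%nat with n by lia. ring. }
    assert (G2 := @is_series_minus C_AbsRing C_NormedModule _ _ _ _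
        (@is_series_minus C_AbsRing C_NormedModule _ _ _ _ (HF w HwD) (HF z Hz))
        (@is_series_scal C_AbsRing C_NormedModule h _ _ G)).
    replace (F w - F z - F1 z * h)%C with
      (@plus C_AbelianGroup (@plus C_AbelianGroup (F w) (@opp C_AbelianGroup (F z)))
         (@opp C_AbelianGroup (@scal C_Ring C_ModuleSpace h (F1 z)))).
    + eapply (@is_series_ext C_AbsRing C_NormedModule); [|exact G2].
      intros n. cbv beta. rewrite !pow_n_Cpow. unfold e.
      change ((w ^ n * b n + - (z ^ n * b n) + - (h * (INR n * z ^ (n - 1) * b n)))%C =
        ((w ^ n - z ^ n - INR n * z ^ (n - 1) * h) * b n)%C). ring.
    + change (F w + - F z + - (h * F1 z) = F w - F z - F1 z * h)%C. ring.
  - apply is_series_decr_1. apply is_series_decr_1.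
    simpl (_ - _)%nat. simpl (INR 0). simpl (INR 1).
    match goal with |- is_series _ ?x => replace x with (Cmod h ^ 2 * S) end.
    + eapply is_series_ext; [|exact (is_series_scal (V := R_NormedModule) (Cmod h ^ 2) _ _ HS)].
      intros n. unfold scal; simpl (Datatypes.S _ - _)%nat. unfold mult; cbn -[INR pow]. rewrite Nat.sub_0_r. ring.
    + unfold plus, opp; simpl. ring.
  - intros n. unfold e. rewrite Cmod_mult. apply Rmult_le_compat_r; [apply Cmod_ge_0|].
    apply pow_second_order; auto. unfold r; lra. }
apply cder_eps. intros eps He. exists (Rmin (r - Cmod z) (eps / (S + 1))). split.
{ apply Rmin_pos; [unfold r; lra|]. apply Rdiv_lt_0_compat; lra. }
intros w Hw.
assert (W1 : Cmod (w - z) < r - Cmod z) by (eapply Rlt_le_trans; [exact Hw|apply Rmin_l]).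
assert (W2 : Cmod (w - z) < eps / (S + 1)) by (eapply Rlt_le_trans; [exact Hw|apply Rmin_r]).
eapply Rle_trans; [apply key; exact W1|].
replace (S * Cmod (w - z) ^ 2) with (S * Cmod (w - z) * Cmod (w - z)) by ring.
apply Rmult_le_compat_r; [apply Cmod_ge_0|].
apply (Rmult_lt_compat_l (S + 1)) in W2; [|lra].
replace ((S + 1) * (eps / (S + 1))) with eps in W2 by (field; lra).
pose proof (Cmod_ge_0 (w - z)). lra.
Qed.

(** Three rounds of differentiation, because z F1 / F has to be twice differentiable as well. *)
Lemma power_series_hol2 b F : power_series_on_D b F ->
  exists F1, hol2 inD F /\ hol2 inD F1 /\ (forall z, inD z -> cder F z (F1 z)).
Proof.
intros H0. destruct (derived_series_exists _ _ H0) as [F1 H1].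
destruct (derived_series_exists _ _ H1) as [F2 H2].
destruct (derived_series_exists _ _ H2) as [F3 H3].
exists F1. split; [|split].
- exists F1, F2. intros z Hz. split; [now apply (power_series_cder b)|now apply (power_series_cder (derived_coef b))].
- exists F2, F3. intros z Hz. split; [now apply (power_series_cder (derived_coef b))|now apply (power_series_cder (derived_coef (derived_coef b)))].
- intros z Hz. now apply (power_series_cder b).
Qed.

(** Division by z shifts the coefficients, so f(z)/z is again a power series, with value a 1 = 1 at
    0; no removable singularity theorem is called for. *)
Lemma class_A_factor (f : C -> C) : class_A f ->
  exists F F1, hol2 inD F /\ hol2 inD F1 /\ (forall z, inD z -> cder F z (F1 z)) /\
    F 0%C = 1%C /\ forall z, inD z -> f z = (z * F z)%C.
Proof.
intros [_ [a [a0 [a1 Ha]]]].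
pose (F := fun z : C => if Ceq_dec z 0 then RtoC 1 else (f z / z)%C).
assert (HF : power_series_on_D (fun n => a (S n)) F).
{ intros z Hz. unfold F. destruct (Ceq_dec z 0) as [->|Hn].
  - rewrite <- a1. apply (@is_pseries_0 C_AbsRing C_NormedModule (fun n => a (S n))).
  - assert (H := @is_pseries_decr_1 C_AbsRing C_NormedModule a z (/ z)%C (f z) (Cinv_l z Hn) (Ha z Hz)).
    replace (f z / z)%C with (@scal C_Ring C_ModuleSpace (/ z)%C (@plus C_AbelianGroup (f z) (@opp C_AbelianGroup (a 0%nat)))).
    + exact H.
    + change (/ z * (f z + - a 0%nat) = f z / z)%C. rewrite a0. field. auto. }
destruct (power_series_hol2 _ _ HF) as [F1 [H1 [H2 H3]]].
exists F, F1. split; [exact H1|split; [exact H2|split; [exact H3|split]]].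
- unfold F. destruct (Ceq_dec (RtoC 0) (RtoC 0)) as [_|n]; [reflexivity|now destruct n].
- intros z Hz. unfold F. destruct (Ceq_dec z 0) as [->|Hn]; [|field; auto].
  assert (H := Ha 0%C Hz).
  assert (E := @is_pseries_0 C_AbsRing C_NormedModule a). rewrite a0 in E.
  replace (0 * 1)%C with (RtoC 0) by ring.
  exact (filterlim_locally_unique (K := C_AbsRing) (V := C_NormedModule) _ _ _ H E).
Qed.

(** * The principal branch of arcsinh *)

Lemma cosh_sq (u : R) : cosh u ^ 2 = 1 + sinh u ^ 2.
Proof.
unfold cosh, sinh. assert (E : exp u * exp (- u) = 1) by (rewrite <- exp_plus, Rplus_opp_r; apply exp_0).
nra.
Qed.

Lemma cosh_pos (u : R) : 0 < cosh u.
Proof. unfold cosh. pose proof (exp_pos u). pose proof (exp_pos (- u)). lra. Qed.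

Lemma sinh_opp (u : R) : sinh (- u) = - sinh u.
Proof. unfold sinh. rewrite Ropp_involutive. field. Qed.

Lemma sinh_ge_id (u : R) : 0 <= u -> u <= sinh u.
Proof.
intros [Hu|<-]; [|rewrite sinh_0; lra].
destruct (MVT_cor2 sinh cosh 0 u Hu) as [c [E _]].
{ intros c _. apply derivable_pt_lim_sinh. }
rewrite sinh_0, !Rminus_0_r in E. rewrite E.
pose proof (cosh_sq c). pose proof (cosh_pos c). nra.
Qed.

Lemma sinh_abs_ge (u : R) : u ^ 2 <= sinh u ^ 2.
Proof.
destruct (Rle_dec 0 u).
- pose proof (sinh_ge_id u). nra.
- pose proof (sinh_ge_id (- u)). rewrite sinh_opp in *. nra.
Qed.

Lemma sinh_sq_diff (r u : R) : sinh r ^ 2 - sinh u ^ 2 = sinh (r + u) * sinh (r - u).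
Proof.
replace (r - u) with (r + - u) by ring.
unfold sinh. rewrite !Ropp_plus_distr, Ropp_involutive, !exp_plus.
assert (E : exp u * exp (- u) = 1) by (rewrite <- exp_plus, Rplus_opp_r; apply exp_0).
assert (E' : exp r * exp (- r) = 1) by (rewrite <- exp_plus, Rplus_opp_r; apply exp_0).
set (a := exp u) in *. set (b := exp (- u)) in *. set (c := exp r) in *. set (d := exp (- r)) in *.
replace ((c * a - d * b) / 2 * ((c * b - d * a) / 2))
  with ((c ^ 2 * (a * b) + d ^ 2 * (a * b) - (c * d) * (a ^ 2 + b ^ 2)) / 4) by field.
replace (((c - d) / 2) ^ 2 - ((a - b) / 2) ^ 2)
  with ((c ^ 2 + d ^ 2 - 2 * (c * d) - (a ^ 2 + b ^ 2) + 2 * (a * b)) / 4) by field.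
rewrite E, E'. field.
Qed.

(** * Complex hyperbolic functions and the inverse of sinh on the disc *)

Definition Csinh (z : C) : C := ((Cexp z - Cexp (- z)) / 2)%C.
Definition Ccosh (z : C) : C := ((Cexp z + Cexp (- z)) / 2)%C.

Lemma Csinh_parts (z : C) : Csinh z = (sinh (Re z) * cos (Im z), cosh (Re z) * sin (Im z)).
Proof.
destruct z as [u v]. unfold Csinh, Cexp, sinh, cosh. apply C_eq; simpl; rewrite cos_neg, sin_neg; field.
Qed.

Lemma Ccosh_parts (z : C) : Ccosh z = (cosh (Re z) * cos (Im z), sinh (Re z) * sin (Im z)).
Proof.
destruct z as [u v]. unfold Ccosh, Cexp, sinh, cosh. apply C_eq; simpl; rewrite cos_neg, sin_neg; field.
Qed.

Lemma Cmod_Csinh_sq (z : C) : Cmod (Csinh z) ^ 2 = sinh (Re z) ^ 2 + sin (Im z) ^ 2.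
Proof.
rewrite Cmod2_alt, Csinh_parts. simpl Re. simpl Im.
rewrite !Rpow_mult_distr, cosh_sq.
assert (cos (Im z) ^ 2 = 1 - sin (Im z) ^ 2) by (pose proof (sin2_cos2 (Im z)); unfold Rsqr in *; lra).
rewrite H. ring.
Qed.

(** With z = u + iv and r = |z|: sin^2 v <= v^2 = (r + u)(r - u) <= sinh (r + u) sinh (r - u) =
    sinh^2 r - sinh^2 u. *)
Lemma Cmod_Csinh_le (z : C) : Cmod (Csinh z) <= sinh (Cmod z).
Proof.
pose proof (Cmod_ge_0 z) as Pz.
apply Rle_of_sq; [pose proof (sinh_ge_id (Cmod z)); lra|].
rewrite Cmod_Csinh_sq.
assert (S : sin (Im z) ^ 2 <= Im z ^ 2).
{ pose proof (abs_sin_le (Im z)) as H. apply Rsqr_le_abs_1 in H. unfold Rsqr in H. nra. }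
pose proof (sinh_sq_diff (Cmod z) (Re z)) as D.
pose proof (re_le_Cmod z) as B. apply Rabs_le_between in B.
pose proof (sinh_ge_id (Cmod z + Re z)). pose proof (sinh_ge_id (Cmod z - Re z)).
pose proof (Cmod2_alt z).
assert ((Cmod z + Re z) * (Cmod z - Re z) <= sinh (Cmod z + Re z) * sinh (Cmod z - Re z)).
{ apply Rmult_le_compat; lra. }
nra.
Qed.

Lemma hol2_Csinh U : hol2 U Csinh.
Proof.
unfold Csinh, Cdiv.
apply hol2_mult; [|apply hol2_const]. apply hol2_plus; [apply hol2_Cexp|].
exists (fun z => (Cexp (- z))%C), (fun z => (- Cexp (- z))%C).
assert (D : forall z, cder (fun z => Cexp (- z)) z (- Cexp (- z))).
{ intros z. eapply cder_eq.
  - apply (cder_comp Cexp (fun z => (- z)%C) z (Cexp (- z)) (-1 * 1)); [apply cder_Cexp|].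
    apply (cder_ext_loc (fun z => (-1 * z)%C) _ _ _ 1 Rlt_0_1); [intros; ring|].
    apply cder_scal, cder_id.
  - ring. }
intros z _. split.
- apply (cder_ext_loc (fun z => (-1 * Cexp (- z))%C) _ _ _ 1 Rlt_0_1); [intros; ring|].
  eapply cder_eq; [apply cder_scal, D|ring].
- apply D.
Qed.

Lemma C_sqrt_unique (s t : C) : right_half s -> right_half t -> (s * s = t * t)%C -> s = t.
Proof.
intros Hs Ht E.
assert (N : (s + t)%C <> 0%C).
{ apply neq0_of_Re. rewrite Re_plus. unfold right_half in *. lra. }
replace s with (t + (s * s - t * t) / (s + t))%C by (field; auto).
rewrite E. field. auto.
Qed.

Lemma right_half_1_sq (w : C) : inD w -> right_half (1 + w * w).
Proof.
intros Hw. unfold inD in Hw. unfold right_half. rewrite Re_plus, Re_mult. change (Re 1) with 1.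
pose proof (Cmod2_alt w). pose proof (Cmod_ge_0 w). nra.
Qed.

Lemma right_half_Cpower (x : C) (a : R) : right_half x -> 0 <= a <= 1 -> right_half (Cpower x a).
Proof.
intros Hx Ha. apply right_half_Cexp. pose proof (Im_Clog_right x Hx) as H.
rewrite Im_mult. simpl (Re (RtoC a)). simpl (Im (RtoC a)). pose proof PI_RGT_0. nra.
Qed.

Lemma Cpower_half_sq (x : C) : x <> 0%C -> (Cpower x (1 / 2) * Cpower x (1 / 2))%C = x.
Proof.
intros Hx. unfold Cpower. rewrite <- Cexp_plus, <- Cmult_plus_distr_r, <- RtoC_plus.
replace (1 / 2 + 1 / 2) with 1 by field. rewrite Cmult_1_l. now apply Cexp_Clog.
Qed.

(** This keeps the argument of the logarithm in [Casinh] off the cut. Let s = x + iy and w = p + iq.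
    If x + p <= 0 then x^2 <= p^2; with xy = pq this gives q^2 <= y^2, against x^2 + q^2 = 1 + p^2 +
    y^2. *)
Lemma right_half_sqrt_plus (w s : C) : right_half s -> (s * s = 1 + w * w)%C -> right_half (w + s).
Proof.
intros Hs E. unfold right_half in *. rewrite Re_plus.
assert (E1 := f_equal Re E). assert (E2 := f_equal Im E).
rewrite Re_plus in E1. rewrite Im_plus in E2. rewrite !Re_mult in E1. rewrite !Im_mult in E2.
change (Re 1) with 1 in E1. change (Im 1) with 0 in E2.
set (x := Re s) in *. set (y := Im s) in *. set (p := Re w) in *. set (q := Im w) in *.
apply Rnot_le_lt. intros K.
assert (F : x * y = p * q) by lra.
assert (F2 : x * x * (y * y) = p * p * (q * q)).
{ replace (x * x * (y * y)) with ((x * y) * (x * y)) by ring. rewrite F. ring. }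
assert (P : x * x <= p * p) by nra.
assert (Pp : 0 < p * p) by nra.
assert (Y : q * q <= y * y).
{ apply Rnot_lt_le. intros Z.
  assert (x * x * (y * y) <= p * p * (y * y)) by (apply Rmult_le_compat_r; nra).
  assert (p * p * (y * y) < p * p * (q * q)) by (apply Rmult_lt_compat_l; nra). lra. }
lra.
Qed.

Lemma Csinh_Casinh (w : C) : inD w -> Csinh (Casinh w) = w.
Proof.
intros Hw. pose proof (right_half_1_sq w Hw) as H1.
unfold Casinh. set (s := Cpower (1 + w * w) (1 / 2)).
assert (Hs : right_half s) by (apply right_half_Cpower; auto; lra).
assert (E : (s * s = 1 + w * w)%C) by (apply Cpower_half_sq; now apply neq0_of_Re).
pose proof (right_half_sqrt_plus w s Hs E) as Hp. apply neq0_of_Re in Hp.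
assert (Em : Cexp (- Clog (w + s)) = (s - w)%C).
{ pose proof (Cexp_opp_mult (Clog (w + s))) as X. rewrite Cexp_Clog in X by auto.
  assert (Y : ((w + s) * (s - w))%C = 1%C).
  { replace ((w + s) * (s - w))%C with (s * s - w * w)%C by ring. rewrite E. ring. }
  rewrite <- (Cmult_1_r (Cexp _)), <- Y, Cmult_assoc, X. ring. }
unfold Csinh. rewrite Em, Cexp_Clog by auto. field.
Qed.

Lemma Casinh_strip (w : C) : inD w -> - (PI / 2) < Im (Casinh w) < PI / 2.
Proof.
intros Hw. pose proof (right_half_1_sq w Hw) as H1. apply Im_Clog_right.
apply right_half_sqrt_plus.
- apply right_half_Cpower; auto; lra.
- apply Cpower_half_sq; now apply neq0_of_Re.
Qed.

Lemma Casinh_region (w : C) : inD w ->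
  sinh (Re (Casinh w)) ^ 2 + sin (Im (Casinh w)) ^ 2 < 1.
Proof.
intros Hw. rewrite <- Cmod_Csinh_sq, Csinh_Casinh by auto. unfold inD in Hw.
pose proof (Cmod_ge_0 w). nra.
Qed.

Lemma arcsinh_1_pos : 0 < arcsinh 1.
Proof. rewrite <- arcsinh_0. apply arcsinh_lt. lra. Qed.

Lemma abs_lt_arcsinh_1 (u : R) : sinh u ^ 2 < 1 -> Rabs u < arcsinh 1.
Proof.
intros H. rewrite <- (arcsinh_sinh (Rabs u)). apply arcsinh_lt.
destruct (Rle_dec 0 u).
- rewrite Rabs_right by lra. nra.
- rewrite Rabs_left, sinh_opp by lra. nra.
Qed.

Lemma Re_Casinh_bound (w : C) : inD w -> Rabs (Re (Casinh w)) < arcsinh 1.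
Proof.
intros Hw. apply abs_lt_arcsinh_1. pose proof (Casinh_region w Hw).
pose proof (pow2_ge_0 (sin (Im (Casinh w)))). lra.
Qed.

(** On the image u^2 <= sinh^2 u < cos^2 v <= (pi/2 - |v|)^2, so even |u| + |v| < pi/2. *)
Lemma Cmod_Casinh_bound (w : C) : inD w -> Cmod (Casinh w) < PI / 2.
Proof.
intros Hw. pose proof PI_RGT_0. apply Cmod_lt_of_sq; [lra|].
pose proof (Casinh_region w Hw) as R. pose proof (Casinh_strip w Hw) as S.
pose proof (sinh_abs_ge (Re (Casinh w))).
set (u := Re (Casinh w)) in *. set (v := Im (Casinh w)) in *.
assert (Ev : sin v ^ 2 = 1 - cos v ^ 2) by (pose proof (sin2_cos2 v); unfold Rsqr in *; lra).
assert (B : cos v ^ 2 <= (PI / 2 - Rabs v) ^ 2).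
{ pose proof (abs_sin_le (PI / 2 - Rabs v)) as T. rewrite sin_shift in T.
  replace (cos (Rabs v)) with (cos v) in T by (unfold Rabs; destruct (Rcase_abs v); auto using cos_neg; now rewrite cos_neg).
  apply Rsqr_le_abs_1 in T. unfold Rsqr in T. lra. }
assert (V : Rabs v < PI / 2) by (apply Rabs_def1; lra).
pose proof (Rabs_pos v). rewrite <- (pow2_abs v). nra.
Qed.

Lemma hol2_Cpower (U : C -> Prop) (f : C -> C) (a : R) :
  (forall z, U z -> right_half (f z)) -> hol2 U f -> hol2 U (fun z => Cpower (f z) a).
Proof.
intros H Hf. unfold Cpower.
apply (hol2_comp _ (fun _ => True) Cexp); auto using hol2_Cexp.
apply hol2_mult; [apply hol2_const|].
apply (hol2_comp _ right_half Clog); auto using hol2_Clog.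
Qed.

Lemma hol2_Casinh : hol2 inD Casinh.
Proof.
unfold Casinh. apply (hol2_comp _ right_half Clog).
- intros w Hw. pose proof (right_half_1_sq w Hw). apply right_half_sqrt_plus.
  + apply right_half_Cpower; auto; lra.
  + apply Cpower_half_sq; now apply neq0_of_Re.
- apply hol2_Clog.
- apply hol2_plus; [apply hol2_id|]. apply hol2_Cpower; [apply right_half_1_sq|].
  apply hol2_plus; [apply hol2_const|]. apply hol2_mult; apply hol2_id.
Qed.

Lemma Casinh_Csinh (z : C) : - (PI / 2) < Im z < PI / 2 -> inD (Csinh z) -> Casinh (Csinh z) = z.
Proof.
intros Hz HD. unfold Casinh.
assert (E : Cpower (1 + Csinh z * Csinh z) (1 / 2) = Ccosh z).
{ pose proof (right_half_1_sq _ HD) as H1. apply C_sqrt_unique.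
  - apply right_half_Cpower; auto; lra.
  - rewrite Ccosh_parts. unfold right_half. simpl. apply Rmult_lt_0_compat; [apply cosh_pos|].
    now apply cos_gt_0.
  - rewrite Cpower_half_sq by now apply neq0_of_Re.
    unfold Csinh, Ccosh. pose proof (Cexp_opp_mult z) as X.
    replace ((Cexp z + Cexp (- z)) / 2 * ((Cexp z + Cexp (- z)) / 2))%C
      with ((Cexp (- z) * Cexp z) + (Cexp z - Cexp (- z)) / 2 * ((Cexp z - Cexp (- z)) / 2))%C by field.
    rewrite X. reflexivity. }
rewrite E. replace (Csinh z + Ccosh z)%C with (Cexp z) by (unfold Csinh, Ccosh; field).
apply Clog_Cexp. pose proof PI_RGT_0. lra.
Qed.

Lemma Casinh_0 : Casinh 0 = 0%C.
Proof.
replace (RtoC 0) with (Csinh 0) at 1.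
- apply Casinh_Csinh; [simpl; pose proof PI_RGT_0; lra|].
  rewrite Csinh_parts. simpl. rewrite sin_0, sinh_0, Rmult_0_l, Rmult_0_r.
  change (inD 0). unfold inD. rewrite Cmod_0. lra.
- rewrite Csinh_parts. simpl. rewrite sin_0, sinh_0, Rmult_0_l, Rmult_0_r. reflexivity.
Qed.

Lemma Cmod_Casinh_le (w : C) : inD w -> Cmod (Casinh w) <= PI / 2 * Cmod w.
Proof.
apply schwarz; [apply hol2_Casinh|apply Casinh_0|].
intros z Hz. left. now apply Cmod_Casinh_bound.
Qed.

(** * Numerical bounds *)

(** Doubling moves the test point to about pi/4, where the Taylor polynomial of degree 6 is precise
    enough; 0.70711 just exceeds 1/sqrt 2, which makes the cosine of the doubled angle positive. *)
Lemma PI_lower : 31415 / 10000 <= PI.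
Proof.
assert (H : 0 < cos (157075 / 100000)).
{ destruct (pre_cos_bound (785375 / 1000000) 1) as [H _]; try lra.
  replace (157075 / 100000) with (2 * (785375 / 1000000)) by field. rewrite cos_2a_cos.
  assert (70711 / 100000 <= cos (785375 / 1000000)); [|nra].
  eapply Rle_trans; [|exact H].
  unfold cos_approx, cos_term. simpl. lra. }
apply Rnot_lt_le. intros K. pose proof PI2_3_2.
pose proof (cos_lt_0 (157075 / 100000)). lra.
Qed.

Lemma le_by_derivative (f g f' g' : R -> R) (X : R) :
  (forall c, derivable_pt_lim f c (f' c)) -> (forall c, derivable_pt_lim g c (g' c)) ->
  f 0 = g 0 -> (forall c, 0 <= c <= X -> f' c <= g' c) ->
  forall x, 0 <= x <= X -> f x <= g x.
Proof.
intros Df Dg E H x [[Hx|<-] HX]; [|lra].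
destruct (MVT_cor2 (fun y => g y - f y) (fun y => g' y - f' y) 0 x Hx) as [c [Q Hc]].
{ intros c _. now apply derivable_pt_lim_minus. }
specialize (H c). simpl in Q. nra.
Qed.

Ltac poly_derivative :=
  intros ?; apply is_derive_Reals; auto_derive; [auto|field].

(** The Taylor polynomial is obtained by integrating cosh >= 1 repeatedly, passing between sinh and
    cosh. *)
Lemma sinh_lower (x : R) : 0 <= x -> x + x ^ 3 / 6 + x ^ 5 / 120 <= sinh x.
Proof.
intros Hx.
assert (c0 : forall c, 0 <= c <= x -> 1 <= cosh c).
{ intros c _. pose proof (cosh_sq c). pose proof (cosh_pos c). pose proof (pow2_ge_0 (sinh c)). nra. }
assert (s0 : forall c, 0 <= c <= x -> c <= sinh c).
{ intros c Hc. apply sinh_ge_id. lra. }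
assert (c1 : forall c, 0 <= c <= x -> 1 + c ^ 2 / 2 <= cosh c).
{ apply (le_by_derivative _ _ (fun c => c) sinh); auto using derivable_pt_lim_cosh.
  - poly_derivative.
  - rewrite cosh_0. field. }
assert (s1 : forall c, 0 <= c <= x -> c + c ^ 3 / 6 <= sinh c).
{ apply (le_by_derivative _ _ (fun c => 1 + c ^ 2 / 2) cosh); auto using derivable_pt_lim_sinh.
  - poly_derivative.
  - rewrite sinh_0. field. }
assert (c2 : forall c, 0 <= c <= x -> 1 + c ^ 2 / 2 + c ^ 4 / 24 <= cosh c).
{ apply (le_by_derivative _ _ (fun c => c + c ^ 3 / 6) sinh); auto using derivable_pt_lim_cosh.
  - poly_derivative.
  - rewrite cosh_0. field. }
apply (le_by_derivative (fun c => c + c ^ 3 / 6 + c ^ 5 / 120) sinh (fun c => 1 + c ^ 2 / 2 + c ^ 4 / 24) cosh x);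
  auto using derivable_pt_lim_sinh; [| |lra].
- poly_derivative.
- rewrite sinh_0. field.
Qed.

(** The same ladder starts from cosh <= 2 on [0, 1], a consequence of e <= 3. The crude start
    survives only in the top coefficient 1/2520 = 2/7!. *)
Lemma sinh_upper (x : R) : 0 <= x <= 1 -> sinh x <= x + x ^ 3 / 6 + x ^ 5 / 120 + x ^ 7 / 2520.
Proof.
assert (c0 : forall c, 0 <= c <= 1 -> cosh c <= 2).
{ intros c Hc. unfold cosh.
  assert (exp c <= exp 1) by (destruct (proj2 Hc) as [h|h]; [left; now apply exp_increasing|rewrite h; lra]).
  assert (exp (- c) <= exp 0).
  { destruct (proj1 Hc) as [h|h]; [left; apply exp_increasing; lra|rewrite <- h, Ropp_0; lra]. }
  rewrite exp_0 in *. pose proof exp_le_3. lra. }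
assert (s0 : forall c, 0 <= c <= 1 -> sinh c <= 2 * c).
{ apply (le_by_derivative _ _ cosh (fun c => 2)); auto using derivable_pt_lim_sinh.
  - poly_derivative.
  - rewrite sinh_0. field. }
assert (c1 : forall c, 0 <= c <= 1 -> cosh c <= 1 + c ^ 2).
{ apply (le_by_derivative _ _ sinh (fun c => 2 * c)); auto using derivable_pt_lim_cosh.
  - poly_derivative.
  - rewrite cosh_0. field. }
assert (s1 : forall c, 0 <= c <= 1 -> sinh c <= c + c ^ 3 / 3).
{ apply (le_by_derivative _ _ cosh (fun c => 1 + c ^ 2)); auto using derivable_pt_lim_sinh.
  - poly_derivative.
  - rewrite sinh_0. field. }
assert (c2 : forall c, 0 <= c <= 1 -> cosh c <= 1 + c ^ 2 / 2 + c ^ 4 / 12).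
{ apply (le_by_derivative _ _ sinh (fun c => c + c ^ 3 / 3)); auto using derivable_pt_lim_cosh.
  - poly_derivative.
  - rewrite cosh_0. field. }
assert (s2 : forall c, 0 <= c <= 1 -> sinh c <= c + c ^ 3 / 6 + c ^ 5 / 60).
{ apply (le_by_derivative _ _ cosh (fun c => 1 + c ^ 2 / 2 + c ^ 4 / 12)); auto using derivable_pt_lim_sinh.
  - poly_derivative.
  - rewrite sinh_0. field. }
assert (c3 : forall c, 0 <= c <= 1 -> cosh c <= 1 + c ^ 2 / 2 + c ^ 4 / 24 + c ^ 6 / 360).
{ apply (le_by_derivative _ _ sinh (fun c => c + c ^ 3 / 6 + c ^ 5 / 60)); auto using derivable_pt_lim_cosh.
  - poly_derivative.
  - rewrite cosh_0. field. }
revert x. apply (le_by_derivative _ _ cosh (fun c => 1 + c ^ 2 / 2 + c ^ 4 / 24 + c ^ 6 / 360)); auto using derivable_pt_lim_sinh.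
- poly_derivative.
- rewrite sinh_0. field.
Qed.

Lemma arcsinh_1_lower : 8813 / 10000 <= arcsinh 1.
Proof.
rewrite <- (arcsinh_sinh (8813 / 10000)). apply arcsinh_le.
eapply Rle_trans; [apply sinh_upper; lra|]. lra.
Qed.

Lemma arcsinh_1_upper : arcsinh 1 < 1.
Proof.
rewrite <- (arcsinh_sinh 1) at 2. apply arcsinh_lt.
eapply Rlt_le_trans; [|apply sinh_lower; lra]. lra.
Qed.

(** Here 2.428 is 1/t = 2.4289... rounded down; the margin is so small that four decimals of pi and
    of arcsinh 1 are needed. *)
Lemma tangent_constant_bounds :
  let t := 4 / PI * sqrt (arcsinh 1 * (1 - arcsinh 1)) in 0 < t <= 1 / (2428 / 1000).
Proof.
pose proof PI_lower. pose proof arcsinh_1_lower. pose proof arcsinh_1_upper.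
set (a := arcsinh 1) in *. intros t.
assert (A : 0 < a * (1 - a)) by nra.
assert (P4 : 0 < 4 / PI) by (apply Rdiv_lt_0_compat; lra).
split.
- apply Rmult_lt_0_compat; auto. now apply sqrt_lt_R0.
- apply Rle_of_sq; [lra|]. unfold t. rewrite Rpow_mult_distr, pow2_sqrt by lra.
  (* The product decreases for a >= 1/2, so a lower bound on arcsinh 1 is the one that counts. *)
  assert (B : a * (1 - a) <= 8813 / 10000 * (1187 / 10000)) by nra.
  assert (C : 4 / PI <= 40000 / 31415).
  { apply Rmult_le_reg_r with PI; [lra|]. unfold Rdiv at 1. rewrite Rmult_assoc, Rinv_l; lra. }
  apply Rle_trans with ((40000 / 31415) ^ 2 * (8813 / 10000 * (1187 / 10000))); [|lra].
  apply Rmult_le_compat; try lra; [apply pow2_ge_0|]. apply pow_incr. lra.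
Qed.

(* The difference of the two sides has a minimum of about [2e-4], near [v = 0.569];
   [7656 / 10000] below is the corresponding value of [y]. *)
Lemma cos_le_sinh_line (v : R) : 0 <= v <= 2 -> cos v <= sinh (1 - v / (2428 / 1000)).
Proof.
intros Hv. set (y := 1 - v / (2428 / 1000)).
assert (Hy : 17 / 100 <= y <= 1) by (unfold y; lra).
eapply Rle_trans; [|apply sinh_lower; lra].
destruct (pre_cos_bound v 0) as [_ H]; try lra.
eapply Rle_trans; [exact H|].
unfold cos_approx, cos_term. simpl.
replace v with (2428 / 1000 * (1 - y)) by (unfold y; field).
clearbody y. clear H Hv v.
set (x := y - 7656 / 10000). replace y with (x + 7656 / 10000) by (unfold x; ring).
assert (Hx : - (6 / 10) <= x <= 2345 / 10000) by (unfold x; lra).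
clearbody x. clear Hy y.
(* The difference expands as c0 + c1 x + x^2 (c2 + c3 x + c4 x^2 + x^3 / 120) with tiny positive c0
   and c1. The bracket exceeds 1, so the square pays for the linear term, as [Q] shows; the summand
   -x^2 / 100 covers the quintic term by [R3]. *)
assert (R : 1 <= 2890 / 1000 + 1573 / 1000 * x - 14162 / 10000 * x ^ 2 - 1 / 100 * x ^ 2) by nra.
assert (R3 : - x ^ 2 <= x * x ^ 2) by nra.
pose proof (pow2_ge_0 x) as P.
assert (S := Rmult_le_compat_l _ _ _ P R).
assert (Q : 0 <= 163 / 1000000 + 151849 / 1000000000 * x + x ^ 2 / 2) by nra.
nra.
Qed.

(** Outside the sector -u >= 1 - t |v| >= 1 - |v| / 2.428, hence sinh (-u) >= cos v > 0 and sinh^2 u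
    + sin^2 v >= 1, which [Casinh_region] excludes. *)
Lemma Casinh_sector (w : C) : inD w ->
  4 / PI * sqrt (arcsinh 1 * (1 - arcsinh 1)) * Rabs (Im (Casinh w)) < 1 + Re (Casinh w).
Proof.
intros Hw. destruct tangent_constant_bounds as [t1 t2].
set (t := 4 / PI * sqrt (arcsinh 1 * (1 - arcsinh 1))) in *.
pose proof (Casinh_region w Hw) as Hr. pose proof (Casinh_strip w Hw) as Hs.
set (u := Re (Casinh w)) in *. set (v := Im (Casinh w)) in *.
assert (V : 0 <= Rabs v < PI / 2) by (split; [apply Rabs_pos|apply Rabs_def1; lra]).
pose proof PI_4.
apply Rnot_le_lt. intros K.
assert (L := cos_le_sinh_line (Rabs v) ltac:(lra)).
replace (cos (Rabs v)) with (cos v) in L by (unfold Rabs; destruct (Rcase_abs v); now rewrite ?cos_neg).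
assert (Cv : 0 < cos v) by (apply cos_gt_0; lra).
assert (Y : 1 - Rabs v / (2428 / 1000) <= - u).
{ assert (t * Rabs v <= 1 / (2428 / 1000) * Rabs v) by (apply Rmult_le_compat_r; lra). lra. }
assert (S : sinh (1 - Rabs v / (2428 / 1000)) <= sinh (- u)).
{ destruct Y as [Y|Y]; [left; now apply sinh_lt|rewrite Y; lra]. }
rewrite sinh_opp in S.
pose proof (sin2_cos2 v). unfold Rsqr in *. nra.
Qed.

(** * Univalence and the four inclusions *)

(** The two functions are the real and imaginary part of (X + iY) exp (-(A + iB)), and the
    hypotheses say that X + iY has logarithmic derivative a + ib. *)
Lemma is_derive_rotated (A B X Y : R -> R) (t a b : R) :
  is_derive A t a -> is_derive B t b ->
  is_derive X t (a * X t - b * Y t) -> is_derive Y t (a * Y t + b * X t) ->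
  is_derive (fun t => exp (- A t) * (X t * cos (B t) + Y t * sin (B t))) t 0 /\
  is_derive (fun t => exp (- A t) * (Y t * cos (B t) - X t * sin (B t))) t 0.
Proof.
intros DA DB DX DY.
assert (EA : Derive (fun x : R => A x) t = a) by now apply is_derive_unique.
assert (EB : Derive (fun x : R => B x) t = b) by now apply is_derive_unique.
assert (EX : Derive (fun x : R => X x) t = a * X t - b * Y t) by now apply is_derive_unique.
assert (EY : Derive (fun x : R => Y x) t = a * Y t + b * X t) by now apply is_derive_unique.
split; (auto_derive; [repeat split; eexists; eassumption|]); rewrite EX, EY, EA, EB; ring.
Qed.

(* With [F (t z) = exp (A t + i B t)], [B] being the integral of
   [Im (z F1 (t z) / F (t z))], the bound on the logarithmic derivative keeps
   [B 1] in [(-pi/2, pi/2)]. *)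
Lemma Re_pos_of_log_derivative_bound (F F1 : C -> C) :
  hol2 inD F -> hol2 inD F1 -> (forall z, inD z -> cder F z (F1 z)) ->
  F 0%C = 1%C -> (forall z, inD z -> F z <> 0%C) ->
  (forall z, inD z -> z <> 0%C -> Cmod (F1 z / F z) <= PI / 2) ->
  forall z, inD z -> right_half (F z).
Proof.
intros HF HF1 D F0 Fn Hb z Hz.
destruct (Ceq_dec z 0) as [->|Zn].
{ rewrite F0. unfold right_half. simpl. lra. }
assert (Pz : 0 < Cmod z) by now apply Cmod_gt_0.
unfold inD in Hz. pose proof PI_RGT_0 as Ppi.
(* Differentiating the integrals at 0 and 1 requires room on both sides of [0, 1]; (1 + dl) |z| < 1
   keeps the longer segment in the disc. *)
set (dl := (1 - Cmod z) / 2).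
assert (Hin : forall s : R, - dl < s < 1 + dl -> inD (0 + s * z)).
{ intros s Hs. unfold inD. replace (0 + s * z)%C with (s * z)%C by ring.
  rewrite Cmod_mult, Cmod_R.
  assert (Rabs s < 1 + dl) by (apply Rabs_def1; unfold dl in *; lra).
  apply Rlt_trans with ((1 + dl) * Cmod z); [apply Rmult_lt_compat_r; lra|unfold dl; nra]. }
set (Q := fun w => (z * (F1 w / F w))%C).
assert (HQ : hol2 inD Q).
{ apply hol2_mult; [apply hol2_const|]. apply hol2_div; auto. }
set (a := fun s : R => Re (Q (0 + s * z)%C)). set (b := fun s : R => Im (Q (0 + s * z)%C)).
assert (Hc : forall s, - dl < s < 1 + dl -> continuous a s /\ continuous b s).
{ intros s Hs. destruct (hol2_cder _ _ HQ _ (Hin s Hs)) as [l L].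
  destruct (cder_line_Re _ _ _ _ _ L) as [A B].
  split; apply (ex_derive_continuous (V := R_NormedModule)); eexists; [exact A|exact B]. }
assert (dl0 : 0 < dl) by (unfold dl; lra).
assert (prim : forall g : R -> R, (forall s, - dl < s < 1 + dl -> continuous g s) ->
  forall t, 0 <= t <= 1 -> is_derive (fun t => RInt g 0 t) t (g t)).
{ intros g Hg t Ht. apply is_derive_RInt with 0; [|apply Hg; lra].
  exists (mkposreal dl dl0). intros y Hy. apply RInt_correct, (ex_RInt_continuous (V := R_CompleteNormedModule)).
  intros s Hs. apply Hg.
  change (Rabs (y - t) < dl) in Hy. apply Rabs_def2 in Hy.
  unfold Rmin, Rmax in Hs. destruct (Rle_dec 0 y); lra. }
set (A := fun t => RInt a 0 t). set (B := fun t => RInt b 0 t).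
assert (DA : forall t, 0 <= t <= 1 -> is_derive A t (a t)) by (apply prim; intros; now apply Hc).
assert (DB : forall t, 0 <= t <= 1 -> is_derive B t (b t)) by (apply prim; intros; now apply Hc).
set (X := fun t : R => Re (F (0 + t * z)%C)). set (Y := fun t : R => Im (F (0 + t * z)%C)).
assert (DXY : forall t, 0 <= t <= 1 ->
   is_derive X t (a t * X t - b t * Y t) /\ is_derive Y t (a t * Y t + b t * X t)).
{ intros t Ht. assert (I : inD (0 + t * z)) by (apply Hin; lra).
  destruct (cder_line_Re _ _ _ _ _ (D _ I)) as [U V].
  assert (E : (F1 (0 + t * z) * z = Q (0 + t * z) * F (0 + t * z))%C) by (unfold Q; field; now apply Fn).
  rewrite E, Re_mult in U. rewrite E, Im_mult in V. unfold X, Y, a, b. split; [exact U|].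
  exact V. }
assert (z0 : (0 + RtoC 0 * z)%C = 0%C) by ring.
assert (z1 : (0 + RtoC 1 * z)%C = z) by ring.
assert (A0 : A 0 = 0) by (unfold A; apply (RInt_point (V := R_CompleteNormedModule))).
assert (B0 : B 0 = 0) by (unfold B; apply (RInt_point (V := R_CompleteNormedModule))).
assert (X0 : X 0 = 1) by (unfold X; rewrite z0, F0; reflexivity).
assert (Y0 : Y 0 = 0) by (unfold Y; rewrite z0, F0; reflexivity).
assert (const : forall g : R -> R, (forall t, 0 <= t <= 1 -> is_derive g t 0) -> g 1 = g 0).
{ intros g Hg. destruct (MVT_cor2 g (fun _ => 0) 0 1 Rlt_0_1) as [c [E _]].
  - intros c Hc'. now apply is_derive_Reals, Hg.
  - lra. }
assert (P1 : exp (- A 1) * (X 1 * cos (B 1) + Y 1 * sin (B 1)) = 1).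
{ transitivity (exp (- A 0) * (X 0 * cos (B 0) + Y 0 * sin (B 0))).
  - apply (const (fun t => exp (- A t) * (X t * cos (B t) + Y t * sin (B t)))).
    intros t Ht. destruct (DXY t Ht) as [U V]. specialize (DA t Ht). specialize (DB t Ht).
    exact (proj1 (is_derive_rotated A B X Y t _ _ DA DB U V)).
  - rewrite A0, B0, X0, Y0, Ropp_0, exp_0, cos_0, sin_0. ring. }
assert (P2 : exp (- A 1) * (Y 1 * cos (B 1) - X 1 * sin (B 1)) = 0).
{ transitivity (exp (- A 0) * (Y 0 * cos (B 0) - X 0 * sin (B 0))).
  - apply (const (fun t => exp (- A t) * (Y t * cos (B t) - X t * sin (B t)))).
    intros t Ht. destruct (DXY t Ht) as [U V]. specialize (DA t Ht). specialize (DB t Ht).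
    exact (proj2 (is_derive_rotated A B X Y t _ _ DA DB U V)).
  - rewrite A0, B0, X0, Y0, Ropp_0, exp_0, cos_0, sin_0. ring. }
(* By the mean value theorem B 1 = b c, and |b c| <= |z| pi/2; strictness comes from |z| < 1. *)
assert (HB : Rabs (B 1) < PI / 2).
{ destruct (MVT_cor2 B b 0 1 Rlt_0_1) as [c [E Hc']].
  - intros c Hc'. now apply is_derive_Reals, DB.
  - replace (B 1) with (b c) by lra. unfold b, Q.
    assert (I : inD (0 + c * z)) by (apply Hin; lra).
    eapply Rle_lt_trans; [apply im_le_Cmod|]. rewrite Cmod_mult.
    assert (Nz : (0 + c * z)%C <> 0%C).
    { apply Cmod_gt_0. replace (0 + c * z)%C with (c * z)%C by ring.
      rewrite Cmod_mult, Cmod_R, Rabs_right by lra. apply Rmult_lt_0_compat; lra. }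
    specialize (Hb _ I Nz). nra. }
apply Rabs_def2 in HB.
assert (Cb : 0 < cos (B 1)) by (apply cos_gt_0; lra).
assert (SC : sin (B 1) * sin (B 1) + cos (B 1) * cos (B 1) = 1) by (exact (sin2_cos2 (B 1))).
assert (E : exp (- A 1) * X 1 = cos (B 1)).
{ transitivity (exp (- A 1) * (X 1 * (sin (B 1) * sin (B 1) + cos (B 1) * cos (B 1)))).
  - rewrite SC. ring.
  - transitivity (exp (- A 1) * (X 1 * cos (B 1) + Y 1 * sin (B 1)) * cos (B 1)
       - exp (- A 1) * (Y 1 * cos (B 1) - X 1 * sin (B 1)) * sin (B 1)); [ring|].
    rewrite P1, P2. ring. }
pose proof (exp_pos (- A 1)). unfold X in E. rewrite z1 in E. unfold right_half.
nra.
Qed.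

(* [G w = log (f (e^w))] has derivative of positive real part on the convex set
   [Re w < 0], so it is injective (Noshiro and Warschawski). *)
Lemma univalent_of_starlike_log (f F F1 : C -> C) :
  (forall z, inD z -> f z = (z * F z)%C) ->
  (forall z, inD z -> cder F z (F1 z)) ->
  (forall z, inD z -> right_half (F z)) ->
  (forall z, inD z -> right_half (1 + z * F1 z / F z)) ->
  forall z1 z2, inD z1 -> inD z2 -> f z1 = f z2 -> z1 = z2.
Proof.
intros Hf D HF HP z1 z2 I1 I2 E.
rewrite (Hf _ I1), (Hf _ I2) in E.
assert (zero : forall z w : C, inD w -> (0 * z = w * F w)%C -> w = 0%C).
{ intros z w Iw Ew. pose proof (neq0_of_Re _ (HF w Iw)) as Fn.
  replace w with ((w * F w) / F w)%C by (field; auto). rewrite <- Ew. field; auto. }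
destruct (Ceq_dec z1 0) as [->|N1]; [symmetry; eauto|].
destruct (Ceq_dec z2 0) as [->|N2]; [eauto|].
pose (G := fun w => (w + Clog (F (Cexp w)))%C).
assert (DG : forall w, Re w < 0 ->
  cder G w (1 + Cexp w * F1 (Cexp w) / F (Cexp w))).
{ intros w Hw. pose proof (inD_Cexp w Hw) as Iw. eapply cder_eq.
  - apply cder_plus; [apply cder_id|].
    apply (cder_comp Clog (fun w => F (Cexp w)) w); [apply cder_Clog, HF, Iw|].
    apply (cder_comp F Cexp w); [apply D, Iw|apply cder_Cexp].
  - field. now apply neq0_of_Re, HF. }
assert (inj : forall w w', Re w < 0 -> Re w' < 0 -> G w = G w' -> w = w').
{ intros w w' Hw Hw' EG. apply NNPP. intros Hn.
  set (d := (w' - w)%C).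
  assert (dn : d <> 0%C).
  { intros Z. apply Hn. replace w' with (w + d)%C by (unfold d; ring). rewrite Z. ring. }
  (* Pairing with the conjugate of d turns the derivative along the segment into |d|^2 Re G', which
     is positive, so u 0 = u 1 is impossible. *)
  set (u := fun t : R => Re (Cconj d * G (w + t * d)%C)%C).
  set (u' := fun t : R => let z := Cexp (w + t * d)%C in
     Re (Cconj d * (1 + z * F1 z / F z) * d)%C).
  destruct (MVT_cor2 u u' 0 1 Rlt_0_1) as [c [Eu Hc]].
  { intros c Hc. apply is_derive_Reals.
    assert (Rc : Re (w + c * d) < 0).
    { unfold d. rewrite Re_plus, Re_mult. simpl (Re c). simpl (Im c).
      unfold Cminus. rewrite Re_plus. change (Re (- w')%C) with (- Re w').
      change (Re (- w)%C) with (- Re w). nra. }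
    exact (proj1 (cder_line_Re _ _ _ _ _ (cder_scal (Cconj d) _ _ _ (DG _ Rc)))). }
  assert (Z : u 1 - u 0 = 0).
  { unfold u. replace (w + 1 * d)%C with w' by (unfold d; ring).
    replace (w + 0 * d)%C with w by ring. rewrite EG. ring. }
  assert (Rc : Re (w + c * d) < 0).
  { unfold d. rewrite Re_plus, Re_mult. simpl (Re c). simpl (Im c).
    unfold Cminus. rewrite Re_plus. change (Re (- w)%C) with (- Re w). nra. }
  pose proof (HP _ (inD_Cexp _ Rc)) as Pp. unfold right_half in Pp.
  unfold u' in Eu. set (p := (1 + Cexp (w + c * d) * F1 (Cexp (w + c * d)) / F (Cexp (w + c * d)))%C) in *.
  cbv zeta in Eu. fold p in Eu.
  replace (Cconj d * p * d)%C with ((d * Cconj d) * p)%C in Eu by ring.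
  rewrite <- Cmod2_conj, Re_mult in Eu. simpl (Re (RtoC _)) in Eu. simpl (Im (RtoC _)) in Eu.
  apply Cmod_gt_0 in dn.
  assert (0 < Cmod d ^ 2 * Re p) by (apply Rmult_lt_0_compat; [nra|exact Pp]).
  simpl in *. lra. }
assert (lnneg : forall z, inD z -> z <> 0%C -> Re (Clog z) < 0).
{ intros z Iz Nz. simpl. rewrite <- ln_1. apply ln_increasing; auto. now apply Cmod_gt_0. }
assert (EG : forall z, inD z -> z <> 0%C -> Cexp (G (Clog z)) = (z * F z)%C).
{ intros z Iz Nz. unfold G. rewrite Cexp_plus, !Cexp_Clog; auto. now apply neq0_of_Re, HF. }
(* Two logarithms of the same number differ by a period of [Cexp]. Since G (w + dd) = G w + dd for a
   period, shifting Clog z2 by dd gives the same value of G as Clog z1; that Cexp dd = 1 is all one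
   needs to know of dd. *)
set (dd := (G (Clog z1) - G (Clog z2))%C).
assert (Ed : Cexp dd = 1%C).
{ assert (T : (Cexp dd * Cexp (G (Clog z2)) = Cexp (G (Clog z2)))%C).
  { rewrite <- Cexp_plus. replace (dd + G (Clog z2))%C with (G (Clog z1)) by (unfold dd; ring).
    rewrite !EG by auto. exact E. }
  pose proof (Cexp_neq0 (G (Clog z2))).
  replace (Cexp dd) with ((Cexp dd * Cexp (G (Clog z2))) / Cexp (G (Clog z2)))%C by (field; auto).
  rewrite T. field; auto. }
assert (Rd : Re dd = 0).
{ pose proof (Cmod_Cexp dd) as T. rewrite Ed, Cmod_1 in T.
  apply exp_inv. rewrite exp_0. auto. }
assert (Ew : Cexp (Clog z2 + dd) = z2).
{ rewrite Cexp_plus, Ed, Cexp_Clog by auto. ring. }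
rewrite <- (Cexp_Clog z1 N1), <- Ew. f_equal. apply inj.
- now apply lnneg.
- rewrite Re_plus, Rd. specialize (lnneg z2 I2 N2). lra.
- unfold G at 2. rewrite Ew. unfold dd, G. rewrite (Cexp_Clog z2) by auto. ring.
Qed.

(** * The quotient z f'/f, transfer of subordination, and the inclusions *)

Lemma zlogder_factor (f : C -> C) : class_A f -> zlogder_defined f ->
  exists F F1, hol2 inD F /\ hol2 inD F1 /\ (forall z, inD z -> cder F z (F1 z)) /\
    F 0%C = 1%C /\ (forall z, inD z -> f z = (z * F z)%C) /\
    (forall z, inD z -> F z <> 0%C) /\
    (forall z, inD z -> zlogder f z = (1 + z * F1 z / F z)%C).
Proof.
intros HA Hd. destruct (class_A_factor f HA) as [F [F1 [H1 [H2 [H3 [H4 H5]]]]]].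
exists F, F1.
assert (Fn : forall z, inD z -> F z <> 0%C).
{ intros z Hz Z. destruct (Ceq_dec z 0) as [->|Nz].
  - rewrite H4 in Z. inversion Z. lra.
  - apply (Hd z Hz Nz). rewrite H5, Z by auto. ring. }
split; [exact H1|split; [exact H2|split; [exact H3|split; [exact H4|split; [exact H5|split; [exact Fn|]]]]]].
intros z Hz. unfold zlogder. destruct (Ceq_dec z 0) as [->|Nz].
- field. now apply Fn.
- assert (DF : cder f z (1 * F z + z * F1 z)).
  { apply (cder_ext_loc (fun z => (z * F z)%C) _ _ _ (1 - Cmod z)).
    - unfold inD in Hz. lra.
    - intros w Hw. symmetry. apply H5. unfold inD. replace w with (z + (w - z))%C by ring.
      eapply Rle_lt_trans; [apply Cmod_triangle|]. lra.
    - apply (cder_mult (fun z => z)); [apply cder_id|now apply H3]. }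
  rewrite (is_C_derive_unique _ _ _ DF), H5 by auto. field. split; auto.
Qed.

(** The new Schwarz function is g after omega: |g(omega z)| <= |omega z| by the Schwarz lemma for g
    at the point omega z, and |omega z| <= |z| by hypothesis. *)
Lemma subordinate_via (p h1 h2 g : C -> C) : subordinate p h1 ->
  hol2 inD g -> g 0%C = 0%C -> (forall w, inD w -> Cmod (g w) <= 1) ->
  (forall w, inD w -> h1 w = h2 (g w)) -> subordinate p h2.
Proof.
intros [om [Ho [o0 [ob oe]]]] Hg g0 gb E.
assert (Ho' : forall z, inD z -> inD (om z)).
{ intros z Hz. unfold inD in *. specialize (ob z Hz). lra. }
exists (fun z => g (om z)). split; [|split; [|split]].
- intros z Hz. destruct (Ho z Hz) as [l Hl].
  destruct (hol2_cder _ _ Hg _ (Ho' z Hz)) as [m Hm].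
  eexists. exact (cder_comp _ _ _ _ _ Hm Hl).
- now rewrite o0.
- intros z Hz. eapply Rle_trans; [|now apply ob].
  rewrite <- (Rmult_1_l (Cmod (om z))). apply schwarz; auto.
- intros z Hz. rewrite oe by auto. now apply E, Ho'.
Qed.

Lemma Cmod_div_le_1 (x y : C) : y <> 0%C -> Re x ^ 2 + Im x ^ 2 <= Re y ^ 2 + Im y ^ 2 ->
  Cmod (x / y) <= 1.
Proof.
intros Hy H. rewrite Cmod_div by auto. apply Cmod_gt_0 in Hy as Py.
rewrite <- !Cmod2_alt in H.
assert (Cmod x <= Cmod y) by (apply Rle_of_sq; [lra|exact H]).
apply Rmult_le_reg_r with (Cmod y); auto. unfold Rdiv. rewrite Rmult_assoc, Rinv_l; lra.
Qed.

Lemma starlike_rho_class_S (f : C -> C) : starlike_rho f -> class_S f.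
Proof.
intros [HA [Hd [om [_ [_ [ob oe]]]]]]. split; auto.
destruct (zlogder_factor f HA Hd) as [F [F1 [H1 [H2 [H3 [H4 [H5 [H6 H7]]]]]]]].
assert (Ho : forall z, inD z -> inD (om z)).
{ intros z Hz. unfold inD in *. specialize (ob z Hz). lra. }
assert (Q : forall z, inD z -> (z * F1 z / F z = Casinh (om z))%C).
{ intros z Hz. specialize (H7 z Hz). rewrite oe in H7 by auto.
  replace (z * F1 z / F z)%C with ((1 + z * F1 z / F z) - 1)%C by ring. rewrite <- H7. ring. }
apply (univalent_of_starlike_log f F F1); auto.
- apply (Re_pos_of_log_derivative_bound F F1); auto.
  intros z Hz Nz.
  (* The division by z is paid for by |om z| <= |z|. *)
  replace (F1 z / F z)%C with (Casinh (om z) / z)%C by (rewrite <- Q by auto; field; auto).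
  rewrite Cmod_div by auto. apply Cmod_gt_0 in Nz.
  apply Rmult_le_reg_r with (Cmod z); auto. unfold Rdiv at 1. rewrite Rmult_assoc, Rinv_l, Rmult_1_r by lra.
  eapply Rle_trans; [apply Cmod_Casinh_le; auto|].
  apply Rmult_le_compat_l; [pose proof PI_RGT_0; lra|auto].
- intros z Hz. rewrite Q by auto. unfold right_half. rewrite Re_plus. change (Re 1) with 1.
  pose proof (Re_Casinh_bound _ (Ho z Hz)) as B. apply Rabs_def2 in B.
  pose proof arcsinh_1_upper. lra.
Qed.

Lemma right_half_1_Casinh (w : C) : inD w -> right_half (1 + Casinh w).
Proof.
intros Hw. unfold right_half. rewrite Re_plus. change (Re 1) with 1.
pose proof (Re_Casinh_bound _ Hw) as B. apply Rabs_def2 in B.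
pose proof arcsinh_1_upper. lra.
Qed.

(** Solving (1 + (1 - 2 alpha) g) / (1 - g) = 1 + s for g gives g = s / (s + c) with c = 2 (1 -
    alpha), and |s| <= |s + c| says that Re s >= -(1 - alpha). *)
Lemma starlike_rho_starlike_order (alpha : R) (f : C -> C) :
  alpha <= 1 - arcsinh 1 -> starlike_rho f -> starlike_order alpha f.
Proof.
intros Ha Hf. split; [now apply starlike_rho_class_S|].
destruct Hf as [_ [_ Hs]].
set (c := RtoC (2 * (1 - alpha))).
assert (Hre : forall w, inD w -> - (1 - alpha) < Re (Casinh w)).
{ intros w Hw. pose proof (Re_Casinh_bound w Hw) as B. apply Rabs_def2 in B. lra. }
pose proof arcsinh_1_pos as a0.
assert (Hn : forall w, inD w -> (Casinh w + c)%C <> 0%C).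
{ intros w Hw. apply neq0_of_Re. rewrite Re_plus. simpl (Re c). specialize (Hre w Hw). lra. }
apply (subordinate_via _ _ _ (fun w => (Casinh w / (Casinh w + c))%C) Hs).
- apply hol2_div; auto using hol2_Casinh. apply hol2_plus; [apply hol2_Casinh|apply hol2_const].
- rewrite Casinh_0. field. unfold c. intros Z. inversion Z. lra.
- intros w Hw. apply Cmod_div_le_1; auto.
  rewrite Re_plus, Im_plus. simpl (Re c). simpl (Im c). specialize (Hre w Hw). nra.
- intros w Hw. specialize (Hn w Hw).
  replace (RtoC (1 - 2 * alpha)) with (c - 1)%C.
  2:{ unfold c. rewrite <- RtoC_minus. f_equal. ring. }
  assert (cn : c <> 0%C) by (unfold c; intros Z; inversion Z; lra).
  field. split; auto.
  replace (Casinh w + c - Casinh w)%C with c by ring. exact cn.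
Qed.

(** Here g is (h - 1) / (h + 1) for the map h of order alpha, which simplifies to (1 - alpha) w / (1
    - alpha w). *)
Lemma starlike_order_starlike (alpha : R) (f : C -> C) :
  0 <= alpha < 1 -> starlike_order alpha f -> starlike f.
Proof.
intros Ha [HS Hs]. split; auto.
assert (Hm : forall w, inD w -> 1 - alpha <= Cmod (1 - alpha * w)).
{ intros w Hw. unfold inD in Hw. pose proof (Cmod_triangle (1 - alpha * w) (alpha * w)) as T.
  replace (1 - alpha * w + alpha * w)%C with (RtoC 1) in T by ring.
  rewrite Cmod_1, Cmod_mult, Cmod_R, Rabs_right in T by lra. nra. }
assert (Hn : forall w, inD w -> (1 - alpha * w)%C <> 0%C).
{ intros w Hw. apply Cmod_gt_0. specialize (Hm w Hw). lra. }
assert (H1 : forall w, inD w -> (1 - w)%C <> 0%C).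
{ intros w Hw Z. unfold inD in Hw. replace w with (1 - (1 - w))%C in Hw by ring.
  rewrite Z in Hw. replace (1 - 0)%C with (RtoC 1) in Hw by ring. rewrite Cmod_1 in Hw. lra. }
apply (subordinate_via _ _ _ (fun w => (RtoC (1 - alpha) * w / (1 - alpha * w))%C) Hs).
- apply hol2_div; auto.
  + apply hol2_mult; [apply hol2_const|apply hol2_id].
  + exists (fun _ => (- alpha)%C), (fun _ => 0%C). intros z _. split; [|apply cder_const].
    apply (cder_ext_loc (fun w => (1 + - alpha * w)%C) _ _ _ 1 Rlt_0_1); [intros; ring|].
    eapply cder_eq.
    * apply cder_plus; [apply cder_const|apply cder_scal, cder_id].
    * ring.
- unfold Cdiv. ring.
- intros w Hw. specialize (Hm w Hw). rewrite Cmod_div by auto.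
  rewrite Cmod_mult, Cmod_R, Rabs_right by lra. unfold inD in Hw. pose proof (Cmod_ge_0 w).
  apply Rmult_le_reg_r with (Cmod (1 - alpha * w)); [lra|].
  unfold Rdiv. rewrite Rmult_assoc, Rinv_l by lra. nra.
- intros w Hw. rewrite !RtoC_minus, !RtoC_mult.
  specialize (Hn w Hw). specialize (H1 w Hw).
  field. repeat split; auto.
  replace (1 - alpha * w - (1 - alpha) * w)%C with (1 - w)%C by ring. exact H1.
Qed.

Lemma starlike_rho_class_M (beta : R) (f : C -> C) :
  1 + arcsinh 1 <= beta -> starlike_rho f -> class_M beta f.
Proof.
intros Hb [HA [Hd [om [_ [_ [ob oe]]]]]]. split; [exact HA|split; [exact Hd|]].
intros z Hz. rewrite oe, Re_plus by auto. change (Re 1) with 1.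
assert (Ho : inD (om z)) by (specialize (ob z Hz); unfold inD in *; lra).
pose proof (Re_Casinh_bound _ Ho) as B. apply Rabs_def2 in B. lra.
Qed.

(** The sector bound says |arg (1 + arcsinh w)| < atan (1/t) <= gamma pi/2, so the power 1/gamma
    lands in the right half-plane, which the Cayley map (Q - 1) / (Q + 1) sends into the disc. *)
Lemma starlike_rho_strongly_starlike (gamma : R) (f : C -> C) :
  let t := 4 / PI * sqrt (arcsinh 1 * (1 - arcsinh 1)) in
  2 / PI * atan (1 / t) <= gamma -> starlike_rho f -> strongly_starlike gamma f.
Proof.
intros t Hg Hf. split; [now apply starlike_rho_class_S|].
destruct Hf as [_ [_ Hs]].
destruct tangent_constant_bounds as [t0 _]. fold t in t0.
pose proof PI_RGT_0 as Ppi.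
assert (at0 : 0 < atan (1 / t)).
{ rewrite <- atan_0. apply atan_increasing. apply Rdiv_lt_0_compat; lra. }
assert (Hg2 : atan (1 / t) <= gamma * (PI / 2)).
{ replace (atan (1 / t)) with (2 / PI * atan (1 / t) * (PI / 2)) by (field; lra).
  apply Rmult_le_compat_r; lra. }
assert (g0 : 0 < gamma) by nra.
set (L := fun w => Clog (1 + Casinh w)).
set (Q := fun w => Cpower (1 + Casinh w) (1 / gamma)).
assert (HL : forall w, inD w -> - (PI / 2) < Im (RtoC (1 / gamma) * L w)%C < PI / 2).
{ intros w Hw. pose proof (right_half_1_Casinh w Hw) as Hp.
  pose proof (Casinh_sector w Hw) as S. fold t in S.
  assert (B : Rabs (Im (L w)) < atan (1 / t)).
  { unfold L. simpl Im. rewrite Carg_atan by auto. unfold right_half in Hp.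
    set (x := Im (1 + Casinh w)%C / Re (1 + Casinh w)%C).
    assert (Hx : Rabs x < 1 / t).
    { unfold x, Rdiv at 1. rewrite Rabs_mult, Rabs_inv, (Rabs_right (Re _)) by lra.
      rewrite Re_plus, Im_plus in *. change (Re 1) with 1 in *. change (Im 1) with 0 in *.
      rewrite Rplus_0_l. apply Rmult_lt_reg_r with (t * (1 + Re (Casinh w))).
      - apply Rmult_lt_0_compat; lra.
      - field_simplify; lra. }
    apply Rabs_def2 in Hx. apply Rabs_def1.
    - now apply atan_increasing.
    - rewrite <- atan_opp. now apply atan_increasing. }
  apply Rabs_def2 in B. rewrite Im_mult. simpl (Re (RtoC _)). simpl (Im (RtoC _)).
  set (y := Im (L w)) in *. rewrite Rmult_0_l, Rplus_0_r.
  split; apply Rmult_lt_reg_l with gamma; auto; field_simplify; lra. }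
assert (HQ : forall w, inD w -> right_half (Q w)).
{ intros w Hw. apply right_half_Cexp, HL, Hw. }
assert (Hn : forall w, inD w -> (Q w + 1)%C <> 0%C).
{ intros w Hw. apply neq0_of_Re. rewrite Re_plus. change (Re 1) with 1.
  specialize (HQ w Hw). unfold right_half in HQ. lra. }
assert (HQ2 : hol2 inD Q).
{ apply hol2_Cpower; [apply right_half_1_Casinh|].
  apply hol2_plus; [apply hol2_const|apply hol2_Casinh]. }
apply (subordinate_via _ _ _ (fun w => ((Q w + -1) / (Q w + 1))%C) Hs).
- apply hol2_div; auto; (apply hol2_plus; [exact HQ2|apply hol2_const]).
- assert (E : Q 0%C = 1%C).
  { unfold Q, Cpower. rewrite Casinh_0. replace (1 + 0)%C with (RtoC 1) by ring.
    rewrite Clog_1. replace (RtoC (1 / gamma) * 0)%C with (RtoC 0) by ring. apply Cexp_0. }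
  rewrite E. replace (1 + -1)%C with (RtoC 0) by ring. unfold Cdiv. ring.
- intros w Hw. apply Cmod_div_le_1; auto. rewrite !Re_plus, !Im_plus.
  change (Re 1) with 1. change (Im 1) with 0. change (Re (-1)) with (-1). change (Im (-1)) with 0.
  specialize (HQ w Hw). unfold right_half in HQ. nra.
- intros w Hw. specialize (Hn w Hw).
  assert (two : (1 + 1)%C <> 0%C) by (intros Z; inversion Z; lra).
  replace ((1 + (Q w + -1) / (Q w + 1)) / (1 - (Q w + -1) / (Q w + 1)))%C with (Q w).
  2:{ field. split; auto. replace (Q w + 1 - (Q w + -1))%C with (1 + 1)%C by ring. exact two. }
  unfold Cpower. unfold Q, Cpower. rewrite Clog_Cexp.
  2:{ specialize (HL w Hw). unfold L in HL. lra. }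
  rewrite Cmult_assoc, <- RtoC_mult. replace (gamma * (1 / gamma)) with 1 by (field; lra).
  rewrite Cmult_1_l, Cexp_Clog; auto. now apply neq0_of_Re, right_half_1_Casinh.
Qed.

(** With q = z f'/f - 1 the hypothesis gives k |q| < 1 + Re q <= 1 + |q|, hence |q| < 1 / (k - 1) <=
    arcsinh 1 and |sinh q| <= sinh |q| < 1. So sinh q is the Schwarz function; arcsinh undoes it
    because |Im q| < pi/2. *)
Lemma kST_starlike_rho (k : R) (f : C -> C) :
  1 + 1 / arcsinh 1 <= k -> class_kST k f -> starlike_rho f.
Proof.
intros Hk [HA [Hd Hkst]]. split; [exact HA|split; [exact Hd|]].
destruct (zlogder_factor f HA Hd) as [F [F1 [H1 [H2 [H3 [H4 [H5 [H6 H7]]]]]]]].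
set (q := fun z => (z * F1 z / F z)%C).
pose proof arcsinh_1_pos as a0. pose proof arcsinh_1_upper as a1.
assert (Hq : forall z, inD z -> Cmod (q z) < arcsinh 1).
{ intros z Hz. specialize (Hkst z Hz). rewrite H7 in Hkst by auto. fold (q z) in Hkst.
  replace (1 + q z - 1)%C with (q z) in Hkst by ring.
  rewrite Re_plus in Hkst. change (Re 1) with 1 in Hkst.
  pose proof (re_le_Cmod (q z)) as R. apply Rabs_le_between in R.
  pose proof (Cmod_ge_0 (q z)).
  assert ((1 + 1 / arcsinh 1) * Cmod (q z) <= k * Cmod (q z)) by (apply Rmult_le_compat_r; lra).
  assert (K : 1 / arcsinh 1 * Cmod (q z) < 1) by lra.
  apply (Rmult_lt_compat_l (arcsinh 1)) in K; auto.
  replace (arcsinh 1 * (1 / arcsinh 1 * Cmod (q z))) with (Cmod (q z)) in K by (field; lra). lra. }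
assert (Hs : forall z, inD z -> Cmod (Csinh (q z)) < 1).
{ intros z Hz. eapply Rle_lt_trans; [apply Cmod_Csinh_le|].
  rewrite <- (sinh_arcsinh 1). apply sinh_lt. now apply Hq. }
assert (Hol : hol2 inD (fun z => Csinh (q z))).
{ apply (hol2_comp _ (fun _ => True)); auto using hol2_Csinh.
  apply hol2_div; auto. apply hol2_mult; [apply hol2_id|exact H2]. }
assert (E0 : Csinh (q 0%C) = 0%C).
{ replace (q 0%C) with (RtoC 0).
  - rewrite Csinh_parts. simpl. rewrite sin_0, sinh_0, Rmult_0_l, Rmult_0_r. reflexivity.
  - unfold q, Cdiv. ring. }
exists (fun z => Csinh (q z)). split; [|split; [exact E0|split]].
- intros z Hz. destruct (hol2_cder _ _ Hol z Hz) as [l Hl]. exists l. exact Hl.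
- intros z Hz. rewrite <- (Rmult_1_l (Cmod z)). apply (schwarz (fun z => Csinh (q z))); auto.
  intros w Hw. left. now apply Hs.
- intros z Hz. rewrite H7 by auto. fold (q z). rewrite Casinh_Csinh; auto; [|now apply Hs].
  pose proof (im_le_Cmod (q z)) as R. specialize (Hq z Hz). pose proof PI2_3_2.
  apply Rabs_le_between in R. lra.
Qed.

Theorem theorem3p1 :
  (forall alpha : R, 0 <= alpha <= 1 - arcsinh 1 ->
     (forall f : C -> C, starlike_rho f -> starlike_order alpha f) /\
     (forall f : C -> C, starlike_order alpha f -> starlike f))
  /\
  (forall beta : R, beta >= 1 + arcsinh 1 ->
     forall f : C -> C, starlike_rho f -> class_M beta f)
  /\
  (forall gamma : R,
     let t := 4 / PI * sqrt (arcsinh 1 * (1 - arcsinh 1)) in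
     2 / PI * atan (1 / t) <= gamma <= 1 ->
     forall f : C -> C, starlike_rho f -> strongly_starlike gamma f)
  /\
  (forall k : R, k >= 1 + 1 / arcsinh 1 ->
     forall f : C -> C, class_kST k f -> starlike_rho f).
Proof.
pose proof arcsinh_1_pos. split; [|split; [|split]].
- intros alpha Ha. split.
  + intros f. now apply starlike_rho_starlike_order.
  + intros f. apply starlike_order_starlike. lra.
- intros beta Hb f. apply starlike_rho_class_M. lra.
- intros gamma t [Hg _] f. now apply starlike_rho_strongly_starlike.
- intros k Hk f. apply kST_starlike_rho. lra.
Qed.
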